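(* Let $N\ge 1$ and $0<s<1$ (with $s<1/2$ if $N=1$). There exists a constant $C>0$, depending only on $N$ and $s$, such that the following holds. Let $u_0\in L^1(\mathbb{R}^N)\cap L^\infty(\mathbb{R}^N)$, $u_0\ge 0$, and let $u\ge 0$ be a (constructed) weak energy solution of the Cauchy problem $$u_t=\nabla\cdot\big(u\,\nabla(-\Delta)^{-s}u\big)\ \text{ in }\mathbb{R}^N\times(0,\infty),\qquad u(\cdot,0)=u_0 .$$ Then for every $t>0$ $$\sup_{x\in\mathbb{R}^N}|u(x,t)|\le C\,t^{-\alpha}\,\|u_0\|_{L^1(\mathbb{R}^N)}^{\gamma},\qquad \alpha=\frac{N}{N+2-2s},\quad \gamma=\frac{2-2s}{N+2-2s}.$$
   Context: Write $r=1-s$. The operator $\mathcal{L}=(-\Delta)^{-s}$ acts in the space variable as convolution with $L(x)=c(N,s)|x|^{-N+2s}$, and $\mathcal{H}=\mathcal{L}^{1/2}$. For real functions $v,w$ put $$\mathcal{B}_r(v,w)=C_N\iint (v(x)-v(y))\frac{1}{|x-y|^{N+2r}}(w(x)-w(y))\,dx\,dy,$$ with $C_N>0$ normalized so that $\mathcal{B}_r(v,w)=\int\nabla v\cdot\nabla\mathcal{L}w\,dx$ for nice $v,w$. Weak solution in $Q_T=\mathbb{R}^N\times(0,T)$ with initial data $u_0\in L^1(\mathbb{R}^N)$: $u\in L^1(Q_T)$, $\mathcal{L}u\in L^1_{loc}(0,T;W^{1,1}_{loc}(\mathbb{R}^N))$, $u\nabla\mathcal{L}u\in L^1(Q_T)$,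 and $$\iint u\,(\eta_t-\nabla\mathcal{L}u\cdot\nabla\eta)\,dx\,dt+\int u_0(x)\eta(x,0)\,dx=0$$ for all $C^1$ test functions $\eta$ in $Q_T$ that are compactly supported in the space variable and vanish near $t=T$. Weak energy solution: a weak solution for which the integrations by parts behind the energy estimates are justified, i.e. the weak identity may also be used with $\eta\in L^2(0,T;H^r(\mathbb{R}^N))$ bounded with $\eta_t\in L^2(Q_T)$ (the spatial term being interpreted through $\mathcal{B}_r$), and, for $f$ smooth and bounded, $F(\sigma)=\int^\sigma f$, and $0\le t_1<t_2\le T$, $$\int F(u(t))\,dx\Big|_{t_1}^{t_2}+\int_{t_1}^{t_2}\int\nabla[f(u)]\cdot u\nabla\mathcal{L}u\,dx\,dt=0,$$ where $\int \nabla[f(u)]\cdot u\nabla\mathcal{L}u\,dx=\mathcal{B}_r(G(u),u)$ with $G'(\sigma)=\sigma f'(\sigma)$; similarly one may test with $\eta=f(u/\varphi)$, $\varphi(x)$ smooth, positive and non-vanishing. The constructed solutions are limits of smooth functions satisfying these identities and, for all $t>0$, satisfy: $u\ge0$; $\int u(x,t)\,dx=\int u_0\,dx$; $u\in L^\infty(\mathbb{R}^N\times(0,\infty))$; the norms $\|u(t)\|_{p}$, $1<p\le\infty$, are non-increasing in $t$; $\nabla\mathcal{H}u\in L^2$ with $\int_0^t\int|\nabla\mathcal{H}u|^2dx\,dt+\int u(t)\log u(t)\,dx\le\int u_0\log u_0\,dx$; and $\int_{t_1}^{t_2}\int u|\nabla\mathcal{L}u|^2dx\,dt+\frac12\int|\mathcal{H}u(t_2)|^2dx\le\frac12\int|\mathcal{H}u(t_1)|^2dx$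 for $0<t_1<t_2$. The class of solutions is invariant under space-time translations and under the scaling $\widehat u(x,t)=A\,u(Bx,Ct)$ with $A,B,C>0$ and $A=CB^{-2+2s}$. *)

(* Defs.v *)
From HB Require Import structures.
From mathcomp Require Import all_boot all_order all_algebra.
From mathcomp Require Import all_classical all_reals all_analysis.

Set Implicit Arguments.
Unset Strict Implicit.
Unset Printing Implicit Defensive.

Import Order.TTheory GRing.Theory Num.Theory.
Import numFieldNormedType.Exports.

Local Open Scope classical_set_scope.
Local Open Scope ring_scope.

(* 'rV[R]_n carries the sigma-algebra generated by the coordinates, which is
   the Borel sigma-algebra. *)
Section measurable_rV.
Context (R : realType) (n : nat).

Definition coord_rV (i : 'I_n) (x : 'rV[R]_n) : R := x ord0 i.

Let rV_set0 : g_sigma_preimage coord_rV set0.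
Proof. exact: sigma_algebra0. Qed.

Let rV_setC A : g_sigma_preimage coord_rV A -> g_sigma_preimage coord_rV (~` A).
Proof. exact: sigma_algebraC. Qed.

Let rV_bigcup (F : _^nat) : (forall i, g_sigma_preimage coord_rV (F i)) ->
  g_sigma_preimage coord_rV (\bigcup_i (F i)).
Proof. exact: sigma_algebra_bigcup. Qed.

HB.instance Definition _ := @isMeasurable.Build default_measure_display
  'rV[R]_n (g_sigma_preimage coord_rV) rV_set0 rV_setC rV_bigcup.



Lemma measurable_coord_rV (i : 'I_n) : measurable_fun [set: 'rV[R]_n] (coord_rV i).
Proof.
move=> _ Y mY; rewrite setTI; apply: sub_sigma_algebra => /=.
by rewrite (bigD1 i)//=; left; exists Y => //; rewrite setTI.
Qed.

Lemma measurable_fun_rV d (T : measurableType d) (f : T -> 'rV[R]_n) :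
  (forall i, measurable_fun [set: T] (coord_rV i \o f)) ->
  measurable_fun [set: T] f.
Proof.
move=> mf.
have sub : g_sigma_preimage (fun i => coord_rV i \o f) `<=` measurable.
  apply: smallest_sub; first exact: sigma_algebra_measurable.
  elim/big_ind : _ => [//|A B sA sB|i _]; first by move=> X [/sA|/sB].
  by move=> A [B mB <-]; exact: mf.
move=> _ A mA; apply: sub.
by rewrite g_sigma_preimage_comp; exists A.
Qed.

End measurable_rV.

Section lebesgue_rV.
Context (R : realType).

Definition cons_rV n (z : measurableTypeR R * 'rV[R]_n) : 'rV[R]_n.+1 :=
  \row_i (if unlift ord0 i is Some j then z.2 ord0 j else z.1).

Lemma measurable_cons_rV n : measurable_fun [set: measurableTypeR R * 'rV[R]_n] (@cons_rV n).
Proof.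
apply: measurable_fun_rV => i; case: (unliftP ord0 i) => [j|] ->.
  rewrite (_ : _ \o _ = coord_rV j \o snd); last first.
    by apply/funext => z; rewrite /coord_rV /= mxE liftK.
  by apply: measurableT_comp => //; exact: measurable_coord_rV.
rewrite (_ : _ \o _ = fst)//.
by apply/funext => z; rewrite /coord_rV /= mxE unlift_none.
Qed.

Definition uncons_rV n (x : 'rV[R]_n.+1) : measurableTypeR R * 'rV[R]_n :=
  (x ord0 ord0, \row_j x ord0 (lift ord0 j)).

Lemma cons_rVK n : cancel (@cons_rV n) (@uncons_rV n).
Proof.
case=> a v; rewrite /uncons_rV mxE unlift_none; congr pair.
by apply/rowP => j; rewrite !mxE liftK.
Qed.

Lemma measurable_uncons_rV n :
  measurable_fun [set: 'rV[R]_n.+1] (@uncons_rV n).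
Proof.
apply/measurable_fun_pairP; split; first exact: measurable_coord_rV.
apply: measurable_fun_rV => j.
rewrite (_ : _ \o _ = coord_rV (lift ord0 j)); first exact: measurable_coord_rV.
by apply/funext => x; rewrite /coord_rV /= mxE.
Qed.

Definition leb_time : {sigma_finite_measure set (measurableTypeR R) -> \bar R} :=
  [the {sigma_finite_measure set _ -> \bar R} of @lebesgue_measure R].

Section step.
Context n (m : {sigma_finite_measure set 'rV[R]_n -> \bar R}).

Definition leb_step : set 'rV[R]_n.+1 -> \bar R :=
  pushforward (leb_time \x m)%E (@cons_rV n).

Let leb_step0 : leb_step set0 = 0%E.
Proof. by rewrite /leb_step /pushforward preimage_set0 measure0. Qed.

Let leb_step_ge0 A : (0 <= leb_step A)%E.
Proof. by rewrite /leb_step /pushforward; exact: measure_ge0. Qed.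

Let leb_step_sigma_additive : semi_sigma_additive leb_step.
Proof.
move=> F mF tF mUF; rewrite /leb_step /pushforward preimage_bigcup.
apply: measure_semi_sigma_additive.
- by move=> k; rewrite -[X in measurable X]setTI; exact: measurable_cons_rV.
- apply/trivIsetP => /= i j _ _ ij; rewrite -preimage_setI.
  by move/trivIsetP : tF => /(_ _ _ _ _ ij) ->//; rewrite preimage_set0.
- rewrite -preimage_bigcup -[X in measurable X]setTI.
  exact: measurable_cons_rV.
Qed.

HB.instance Definition _ := isMeasure.Build _ _ _
  leb_step leb_step0 leb_step_ge0 leb_step_sigma_additive.

Let leb_step_sigma_finite : sigma_finite setT leb_step.
Proof.
have /sigma_finiteP[F [FT ndF Foo]] := sigma_finiteT (@leb_time).
have /sigma_finiteP[G [GT ndG Goo]] := sigma_finiteT m.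
exists (fun k => @uncons_rV n @^-1` (F k `*` G k)).
  rewrite -preimage_bigcup (_ : \bigcup_k _ = setT) ?preimage_setT//.
  rewrite -subTset => -[x y] _.
  have [i _ Fx] : (\bigcup_k F k) x by rewrite -FT.
  have [j _ Gy] : (\bigcup_k G k) y by rewrite -GT.
  exists (maxn i j) => //; split => /=.
    by move: x Fx; exact/subsetPset/ndF/leq_maxl.
  by move: y Gy; exact/subsetPset/ndG/leq_maxr.
move=> k; have [mF Fk] := Foo k; have [mG Gk] := Goo k.
have mFG : measurable (F k `*` G k) by exact: measurableX.
split.
  by rewrite -[X in measurable X]setTI; exact: measurable_uncons_rV.
rewrite /leb_step /pushforward -comp_preimage.
rewrite (_ : _ \o _ = id) ?preimage_id; last first.
  by apply/funext => z; exact: cons_rVK.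
by rewrite product_measure1E// lte_mul_pinfty// ge0_fin_numE.
Qed.

HB.instance Definition _ := Measure_isSigmaFinite.Build _ _ _
  leb_step leb_step_sigma_finite.

End step.

(* Lebesgue measure on 'rV[R]_n: the n-fold product of Lebesgue measure on R. *)
Fixpoint leb (n : nat) : {sigma_finite_measure set 'rV[R]_n -> \bar R} :=
  match n with
  | 0 => [the {sigma_finite_measure set _ -> \bar R} of \d_ (0 : 'rV[R]_0)]
  | k.+1 => [the {sigma_finite_measure set _ -> \bar R} of leb_step (leb k)]
  end.

End lebesgue_rV.

Arguments leb_time {R}.

Section vector_calculus.
Context (R : realType) (N : nat).
Implicit Types (x y : 'rV[R]_N) (v w : 'rV[R]_N -> R).

Definition dot x y : R := \sum_(i < N) x ord0 i * y ord0 i.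

(* The norm of the library on 'rV[R]_N is the sup norm. *)
Definition enorm x : R := Num.sqrt (dot x x).

Definition grad v x : 'rV[R]_N := \row_i 'D_(delta_mx ord0 i) v x.

(* All iterated directional derivatives exist and are differentiable on A. *)
Definition smooth_on (V : normedModType R) (A : set V) (f : V -> R) : Prop :=
  forall (ds : seq V) (x : V), A x ->
    differentiable (foldr (fun d g => 'D_d g) f ds : V -> R) x.

Definition loc_integrable v : Prop :=
  forall K : set 'rV[R]_N, compact K -> (leb R N).-integrable K (EFin \o v).

Definition test_function (phi : 'rV[R]_N -> R) : Prop :=
  smooth_on [set: 'rV[R]_N] phi /\
  exists2 K : set 'rV[R]_N, compact K & forall x, ~ K x -> phi x = 0.

Definition weak_gradient v (g : 'rV[R]_N -> 'rV[R]_N) : Prop :=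
  [/\ loc_integrable v,
      forall i, loc_integrable (fun x => g x ord0 i) &
      forall phi, test_function phi -> forall i,
        \int[leb R N]_x (v x * 'D_(delta_mx ord0 i) phi x) =
        - \int[leb R N]_x (g x ord0 i * phi x)].

Definition C1_spacetime (eta : R -> 'rV[R]_N -> R) : Prop :=
  [/\ forall t x, derivable (eta ^~ x) t 1,
      forall t x i, derivable (eta t) x (delta_mx ord0 i),
      continuous (fun z : R * 'rV[R]_N => eta z.1 z.2),
      continuous (fun z : R * 'rV[R]_N => derive1 (eta ^~ z.2) z.1) &
      continuous (fun z : R * 'rV[R]_N => grad (eta z.1) z.2)].

End vector_calculus.

Section spacetime.
Context (R : realType) (N : nat).

Definition leb_st : {measure set (measurableTypeR R * 'rV[R]_N) -> \bar R} :=
  [the {measure set _ -> \bar R} of (leb_time \x leb R N)%E].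

Definition strip (a b : R) : set (measurableTypeR R * 'rV[R]_N) := `]a, b[ `*` setT.

End spacetime.

Arguments leb_st {R N}.
Arguments strip {R N}.

Section potentials.
Context (R : realType) (N : nat).
Implicit Types (v w : 'rV[R]_N -> R).

Definition Gamma (p : R) : R :=
  \int[@lebesgue_measure R]_(t in `]0, +oo[) (t `^ (p - 1) * expR (- t)).

Definition riesz_const (sigma : R) : R :=
  Gamma (N%:R / 2 - sigma) / (4 `^ sigma * pi `^ (N%:R / 2) * Gamma sigma).

Definition riesz_kernel (sigma : R) (x : 'rV[R]_N) : R :=
  riesz_const sigma * enorm x `^ (2 * sigma - N%:R).

(* (-Delta)^{-sigma}, for 0 < 2 sigma < N *)
Definition riesz_potential (sigma : R) v (x : 'rV[R]_N) : R :=
  \int[leb R N]_y (riesz_kernel sigma (x - y) * v y).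

Definition opL (s : R) v := riesz_potential s v.

(* The square root of (-Delta)^{-s} is (-Delta)^{-s/2}. *)
Definition opH (s : R) v := riesz_potential (s / 2) v.

(* - Delta |x|^{2s-N} = (N-2s)(2-2s) |x|^{-N-2(1-s)} away from 0; hence this is
   the constant for which B_{1-s}(v, w) is the integral of grad v . grad (L w).
   It equals 4^r r Gamma(N/2 + r) / (2 pi^{N/2} Gamma(1 - r)) with r = 1 - s. *)
Definition bilin_const (s : R) : R :=
  riesz_const s * (N%:R - 2 * s) * (1 - s).

Definition bilin_integrand (s : R) v w (z : 'rV[R]_N * 'rV[R]_N) : R :=
  (v z.1 - v z.2) * (w z.1 - w z.2) / enorm (z.1 - z.2) `^ (N%:R + 2 * (1 - s)).

Definition bilin (s : R) v w : R :=
  bilin_const s * \int[(leb R N \x leb R N)%E]_z bilin_integrand s v w z.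

(* The integrals over (a, b) of B_{1-s}(v(t), w(t)) converge absolutely. *)
Definition bilin_integrable (s a b : R) (v w : R -> 'rV[R]_N -> R) : Prop :=
  {ae leb_time, forall t, a < t < b -> (leb R N \x leb R N)%E.-integrable setT
     (EFin \o bilin_integrand s (v t) (w t))} /\
  leb_time.-integrable `]a, b[ (fun t => (bilin s (v t) (w t))%:E).

(* Squared norm of H^r(R^N), 0 < r < 1. *)
Definition sqnormH (r : R) v : \bar R :=
  (\int[leb R N]_x ((v x) ^+ 2)%:E +
   \int[(leb R N \x leb R N)]_z
     ((v z.1 - v z.2) ^+ 2 / enorm (z.1 - z.2) `^ (N%:R + 2 * r))%:E)%E.

Definition in_L2H (r T : R) (v : R -> 'rV[R]_N -> R) : Prop :=
  measurable_fun (strip 0 T) (fun z => v z.1 z.2) /\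
  (\int[leb_time]_(t in `]0%R, T[) sqnormH r (v t) < +oo)%E.

End potentials.

Section solutions.
Context (R : realType) (N : nat) (s : R).
Implicit Types (u eta : R -> 'rV[R]_N -> R).
(* p is the gradient of L u and q the gradient of H u. *)
Implicit Types (p q : R -> 'rV[R]_N -> 'rV[R]_N).

(* C^1 functions on the closed strip extend to C^1 functions on R x R^N. *)
Definition spacetime_test (T : R) eta : Prop :=
  [/\ C1_spacetime eta,
      exists2 K : set 'rV[R]_N, compact K &
        forall t x, 0 <= t <= T -> ~ K x -> eta t x = 0 &
      exists2 d : R, 0 < d & forall t x, T - d < t <= T -> eta t x = 0].

Definition weak_solution (T : R) (u0 : 'rV[R]_N -> R) u p : Prop :=
  [/\ (leb R N).-integrable setT (EFin \o u0),
      leb_st.-integrable (strip 0 T) (fun z => (u z.1 z.2)%:E),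
      [/\ {ae leb_time, forall t, 0 < t < T -> weak_gradient (opL s (u t)) (p t)},
          forall (a b : R) (K : set 'rV[R]_N), 0 < a -> a < b -> b < T -> compact K ->
            leb_st.-integrable (`[a, b] `*` K) (fun z => (opL s (u z.1) z.2)%:E) &
          forall (a b : R) (K : set 'rV[R]_N), 0 < a -> a < b -> b < T -> compact K ->
            forall i, leb_st.-integrable (`[a, b] `*` K)
              (fun z => (p z.1 z.2 ord0 i)%:E)],
      forall i, leb_st.-integrable (strip 0 T)
        (fun z => (u z.1 z.2 * p z.1 z.2 ord0 i)%:E) &
      forall eta, spacetime_test T eta ->
        \int[leb_st]_(z in strip 0 T)
          (u z.1 z.2 * (derive1 (eta ^~ z.2) z.1
             - dot (p z.1 z.2) (grad (eta z.1) z.2))) +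
        \int[leb R N]_x (u0 x * eta 0 x) = 0].

(* Bounded functions eta in L^2(0,T; H^{1-s}) with time derivative zeta in
   L^2(Q_T), vanishing near t = T; eta is the representative that is
   absolutely continuous in time. *)
Definition energy_test (T : R) eta (zeta : R -> 'rV[R]_N -> R) : Prop :=
  [/\ in_L2H (1 - s) T eta,
      exists M : R, forall t x, 0 <= t <= T -> `|eta t x| <= M,
      measurable_fun [set: 'rV[R]_N] (eta 0) /\
        (measurable_fun (strip 0 T) (fun z => zeta z.1 z.2) /\
         leb_st.-integrable (strip 0 T) (fun z => ((zeta z.1 z.2) ^+ 2)%:E)),
      forall t, 0 <= t <= T -> {ae leb R N, forall x,
        eta t x = eta 0 x + \int[leb_time]_(tau in `[0, t]) zeta tau x} &
      exists2 d : R, 0 < d & forall t x, T - d < t <= T -> eta t x = 0].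

(* For eta only in H^{1-s} the term "integral of u grad eta . grad (L u)" is
   read through the bilinear form: when u grad eta = grad psi + g with psi in
   L^2(0,T; H^{1-s}) and |g| <= M |u|, it is the integral over (0,T) of
   B_{1-s}(psi, u) plus the integral of g . grad (L u). *)
Definition extended_weak_identity (T : R) (u0 : 'rV[R]_N -> R) u p : Prop :=
  forall eta zeta (deta : R -> 'rV[R]_N -> 'rV[R]_N) (psi : R -> 'rV[R]_N -> R)
         (g : R -> 'rV[R]_N -> 'rV[R]_N) (M : R),
    energy_test T eta zeta ->
    leb_st.-integrable (strip 0 T) (fun z => (u z.1 z.2 * zeta z.1 z.2)%:E) ->
    {ae leb_time, forall t, 0 < t < T -> weak_gradient (eta t) (deta t)} ->
    (forall i, measurable_fun (strip 0 T) (fun z => g z.1 z.2 ord0 i)) ->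
    (forall t x, enorm (g t x) <= M * `|u t x|) ->
    in_L2H (1 - s) T psi ->
    {ae leb_time, forall t, 0 < t < T ->
      weak_gradient (psi t) (fun x => u t x *: deta t x - g t x)} ->
    bilin_integrable s 0 T psi u ->
    \int[leb_st]_(z in strip 0 T) (u z.1 z.2 * zeta z.1 z.2)
    - (\int[leb_time]_(t in `]0, T[) bilin s (psi t) (u t)
       + \int[leb_st]_(z in strip 0 T) dot (g z.1 z.2) (p z.1 z.2))
    + \int[leb R N]_x (u0 x * eta 0 x) = 0.

(* f smooth and bounded, F' = f and G'(sigma) = sigma f'(sigma); F and G are
   normalized to vanish at 0 so that F(u) is integrable over R^N. *)
Definition energy_nonlinearity (f F G : R -> R) : Prop :=
  [/\ forall n x, derivable (derive1n n f) x 1,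
      exists M : R, forall x, `|f x| <= M,
      F 0 = 0 /\ (forall x : R, is_derive x 1 F (f x)) &
      G 0 = 0 /\ (forall x : R, is_derive x 1 G (x * derive1 f x))].

Definition energy_identity u : Prop :=
  forall f F G, energy_nonlinearity f F G ->
  forall t1 t2, 0 <= t1 -> t1 < t2 ->
    [/\ (leb R N).-integrable setT (fun x => (F (u t1 x))%:E),
        (leb R N).-integrable setT (fun x => (F (u t2 x))%:E),
        bilin_integrable s t1 t2 (fun t x => G (u t x)) u &
        \int[leb R N]_x F (u t2 x) - \int[leb R N]_x F (u t1 x)
        + \int[leb_time]_(t in `]t1, t2[) bilin s (fun x => G (u t x)) (u t) = 0].

(* Testing with f(u / phi): since u grad f(u/phi) = phi grad G(u/phi)
   = grad (phi G(u/phi)) - G(u/phi) grad phi, the spatial term is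
   B_{1-s}(phi G(u/phi), u) minus the integral of
   G(u/phi) grad phi . grad (L u). *)
Definition weighted_energy_identity u p : Prop :=
  forall f F G (phi : 'rV[R]_N -> R), energy_nonlinearity f F G ->
    smooth_on setT phi -> (forall x, 0 < phi x) ->
  forall t1 t2, 0 <= t1 -> t1 < t2 ->
    (leb R N).-integrable setT (fun x => (phi x * F (u t1 x / phi x))%:E) ->
    (leb R N).-integrable setT (fun x => (phi x * F (u t2 x / phi x))%:E) ->
    bilin_integrable s t1 t2 (fun t x => phi x * G (u t x / phi x)) u ->
    leb_st.-integrable (strip t1 t2) (fun z =>
      (G (u z.1 z.2 / phi z.2) * dot (grad phi z.2) (p z.1 z.2))%:E) ->
    \int[leb R N]_x (phi x * F (u t2 x / phi x))
    - \int[leb R N]_x (phi x * F (u t1 x / phi x))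
    + (\int[leb_time]_(t in `]t1, t2[)
         bilin s (fun x => phi x * G (u t x / phi x)) (u t)
       - \int[leb_st]_(z in strip t1 t2)
           (G (u z.1 z.2 / phi z.2) * dot (grad phi z.2) (p z.1 z.2))) = 0.

Definition weak_energy_solution (u0 : 'rV[R]_N -> R) u p : Prop :=
  [/\ {ae leb R N, forall x, u 0 x = u0 x},
      forall T, 0 < T -> weak_solution T u0 u p,
      forall T, 0 < T -> extended_weak_identity T u0 u p,
      energy_identity u &
      weighted_energy_identity u p].

Definition limit_of_smooth u : Prop :=
  exists (v0 : nat -> 'rV[R]_N -> R) (v : nat -> R -> 'rV[R]_N -> R)
         (pv : nat -> R -> 'rV[R]_N -> 'rV[R]_N),
    (forall n, weak_energy_solution (v0 n) (v n) (pv n) /\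
       smooth_on [set z : R * 'rV[R]_N | 0 < z.1] (fun z => v n z.1 z.2)) /\
    forall (T : R) (K : set 'rV[R]_N), 0 < T -> compact K ->
      (\int[leb_st]_(z in `]0%R, T[ `*` K) `|v n z.1 z.2 - u z.1 z.2|%:E)%E
        @[n --> \oo] --> 0%E.

Record constructed_properties (u0 : 'rV[R]_N -> R) u p q : Prop := {
  cp_energy : weak_energy_solution u0 u p ;
  cp_limit : limit_of_smooth u ;
  cp_ge0 : forall t, 0 < t -> {ae leb R N, forall x, 0 <= u t x} ;
  cp_integrable : forall t, 0 < t -> (leb R N).-integrable setT (EFin \o u t) ;
  cp_mass : forall t, 0 < t -> \int[leb R N]_x u t x = \int[leb R N]_x u0 x ;
  cp_bounded : exists M : R,
    {ae leb_st, forall z : R * 'rV[R]_N, 0 < z.1 -> `|u z.1 z.2| <= M} ;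
  cp_norm : forall (k : \bar R) (t1 t2 : R), (1 < k)%E -> 0 < t1 -> t1 <= t2 ->
    ('N[leb R N]_k[EFin \o u t2] <= 'N[leb R N]_k[EFin \o u t1])%E ;
  cp_gradH : {ae leb_time, forall t : R, 0 < t -> weak_gradient (opH s (u t)) (q t)} ;
  cp_gradH_L2 : forall (t : R) i, 0 < t ->
    measurable_fun (strip 0 t) (fun z => q z.1 z.2 ord0 i) /\
    leb_st.-integrable (strip 0 t) (fun z => ((q z.1 z.2 ord0 i) ^+ 2)%:E) ;
  cp_entropy : forall t : R, 0 < t ->
    (\int[leb_st]_(z in strip 0 t) ((enorm (q z.1 z.2)) ^+ 2)%:E
     + \int[leb R N]_x (u t x * ln (u t x))%:E
     <= \int[leb R N]_x (u0 x * ln (u0 x))%:E)%E ;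
  cp_energy_H : forall t1 t2 : R, 0 < t1 -> t1 < t2 ->
    (\int[leb_st]_(z in strip t1 t2) (u z.1 z.2 * (enorm (p z.1 z.2)) ^+ 2)%:E
     + 2^-1%:E * \int[leb R N]_x ((opH s (u t2) x) ^+ 2)%:E
     <= 2^-1%:E * \int[leb R N]_x ((opH s (u t1) x) ^+ 2)%:E)%E
}.

(* A class of pairs (initial datum, solution) whose members have the properties
   above and which is invariant under space-time translations and scaling. *)
Definition solution_class
    (S : ('rV[R]_N -> R) -> (R -> 'rV[R]_N -> R) -> Prop) : Prop :=
  [/\ forall (u0 : 'rV[R]_N -> R) u, S u0 u -> exists p q, constructed_properties u0 u p q,
      forall (u0 : 'rV[R]_N -> R) u (a : 'rV[R]_N) (h : R), 0 <= h -> S u0 u ->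
        S (fun x => u h (x + a)) (fun t x => u (t + h) (x + a)) &
      forall (u0 : 'rV[R]_N -> R) u (A B C : R), 0 < A -> 0 < B -> 0 < C ->
        A = C * B `^ (- 2 + 2 * s) -> S u0 u ->
        S (fun x => A * u0 (B *: x)) (fun t x => A * u (C * t) (B *: x))].

Definition constructed_solution (u0 : 'rV[R]_N -> R) u : Prop :=
  exists2 S, solution_class S & S u0 u.

End solutions.

(* Main.v *)
Require Import Defs.
From mathcomp Require Import all_boot all_order all_algebra.
From mathcomp Require Import all_classical all_reals all_analysis.
From mathcomp Require Import measurable_realfun ess_sup_inf ring lra.

Set Implicit Arguments.
Unset Strict Implicit.
Unset Printing Implicit Defensive.

Import Order.TTheory GRing.Theory Num.Theory.
Import numFieldNormedType.Exports.

Local Open Scope classical_set_scope.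
Local Open Scope ring_scope.

(** The estimate follows from a De Giorgi iteration on the excess masses
      U(l, t) = integral of (u(t) - l)_+ .

    Take for f in the energy identity an increasing function that is close to
    the indicator of (l, +oo).  Then F(u) is close to (u - l)_+, while
    G(u) = u f(u) - F(u) is nondecreasing in u and jumps by about l when u
    crosses the level l.  Hence U(l, .) is nonincreasing, and its dissipation
    between two times is at least the time integral of
      c l * double integral of (u(x) - l) / |x - y|^(N + 2r)
            over u(x) > l >= u(y),                                  r = 1 - s.
    For fixed x the inner integral over the complement of E = {u > l} is
    smallest, for a given volume of E, when E is concentrated around x; a cube
    of volume 2|E| around x still contains a volume |E| outside E, which bounds
    this inner integral from below by a multiple of |E|^(-beta), with
    beta = 2r/N ([bilin_ge_excess], [cube_side]).  The dissipation therefore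
    controls c l |E|^(-beta) U(l, t).

    By Chebyshev's inequality |{u > l}| <= U(l', t) / (l - l') for l' < l.  With
    the monotonicity in time this gives, for a < b and t1 < t2,
      (t2 - t1) a ((b - a) / U(a, t1))^beta U(b, t2) <= C U(a, t1)
    ([excess_step]), a recursion with the superlinear power 1 + beta.  It is
    iterated along levels increasing from L/2 to L and times increasing from
    t/2 to t: U decays geometrically as soon as t L^(1 + beta) is a large
    multiple of m^beta, m being the mass of u ([excess_eq0]).  For such an L
    we get U(L, t) = 0, that is u(t) <= L almost everywhere, and
    1/(1 + beta) = alpha, beta/(1 + beta) = gamma.

    The solution enters through the energy identity, its nonnegativity and the
    conservation of mass.  The smooth bounded f are logistic functions
    ([approximate_step]); their steepness is eventually sent to infinity, but
    only in the resulting numerical inequalities ([le_of_le_add_small]).  The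
    positivity of the constant in front of the bilinear form rests on that of
    Euler's Gamma function ([Gamma_gt0]). *)

(** * Positivity of the Gamma function *)

Lemma powR_le_fact_expR (R : realType) (q t : R) (n : nat) :
  0 <= q -> q <= n.+1%:R -> 0 < t -> t `^ q <= (n.+1)`!%:R * expR t.
Proof.
move=> q0 qn t0.
have fact1 : 1 <= (n.+1)`!%:R :> R by rewrite ler1n fact_gt0.
have [t1|t1] := leP t 1.
  apply: (@le_trans _ _ 1).
    have -> : 1 = 1 `^ q :> R by rewrite powR1.
    by rewrite ge0_ler_powR ?nnegrE// ltW.
  by rewrite -[leLHS]mulr1 ler_pM// -[leLHS]expR0 ler_expR ltW.
apply: (@le_trans _ _ (t ^+ n.+1)).
  by rewrite -powR_mulrn ?(ltW t0)// ler_powR// ltW.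
rewrite mulrC -ler_pdivrMr ?ltr0n ?fact_gt0//.
by apply: le_trans (expR_ge1Dxn n (ltW t0)); rewrite lerDr.
Qed.

(** The integrand is the derivative of t^p / (1 + t^p), which has values in
    [0, 1]; it is comparable with t^(p - 1) near 0 and decays like a power at
    infinity, so that a multiple of it dominates the integrand of Gamma. *)
Lemma integral_powR_rational_le (R : realType) (p a b : R) :
  0 < p -> 0 < a -> a < b ->
  (\int[@lebesgue_measure R]_(t in `[a, b])
     (p * t `^ (p - 1) * (1 + t `^ p) ^- 2)%:E <= 1)%E.
Proof.
move=> p0 a0 ab.
have pos (t : R) : 0 < 1 + t `^ p by rewrite ltr_pwDl// powR_ge0.
pose F (t : R) : R := - (1 + t `^ p)^-1.
have dF (t : R) : 0 < t ->
    is_derive t 1 F (p * t `^ (p - 1) * (1 + t `^ p) ^- 2).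
  move=> t0.
  have dpow := is_derive1_powR p t0.
  have d1 : is_derive t 1 (fun y : R => 1 + y `^ p) (p * t `^ (p - 1)).
    by rewrite -[X in is_derive _ _ _ X]add0r; apply: is_deriveD.
  have dinv := @is_deriveV _ (fun y : R => 1 + y `^ p) _ _ _ (lt0r_neq0 (pos t)) d1.
  rewrite (_ : _ * _ = - (- (1 + t `^ p) ^- 2 *: (p * t `^ (p - 1)))); last first.
    by rewrite scaleNr opprK mulrC.
  exact: is_deriveN.
rewrite (@continuous_FTC2 _ _ F)//.
- rewrite -EFinB lee_fin /F opprK addrC.
  apply: (@le_trans _ _ (1 + a `^ p)^-1); first by rewrite gerDl oppr_le0 invr_ge0 ltW.
  by rewrite invf_le1// lerDl powR_ge0.
- apply: continuous_in_subspaceT => t; rewrite inE/= in_itv/= => /andP[at_ _].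
  have t0 : 0 < t by exact: lt_le_trans at_.
  have cpow q : {for t, continuous (fun y : R => y `^ q)}.
    apply: differentiable_continuous; apply/derivable1_diffP.
    by apply: derivable_powR; rewrite in_itv/= t0.
  apply: cvgM; first by apply: cvgM; [exact: cvg_cst|exact: cpow].
  apply: cvgV; first by rewrite expf_neq0// lt0r_neq0.
  apply: (@cvg_comp _ _ _ _ (fun x : R => x ^+ 2)); last exact: exprn_continuous.
  by apply: cvgD; [exact: cvg_cst|exact: cpow].
- have cF (t : R) : 0 < t -> {for t, continuous F}.
    by move=> /dF dFt; apply: differentiable_continuous; apply/derivable1_diffP; case: dFt.
  split.
  + by move=> t; rewrite in_itv/= => /andP[/(lt_trans a0)/dF dFt _]; case: dFt.
  + by apply: cvg_at_right_filter; exact: cF.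
  + by apply: cvg_at_left_filter; apply: cF; exact: lt_trans ab.
- move=> t; rewrite in_itv/= => /andP[/(lt_trans a0)/dF dFt _].
  by rewrite derive1E; case: dFt.
Qed.

(** As Gamma is defined by a real-valued integral, which is 0 when the integral
    diverges, its positivity includes the convergence of the integral. *)
Lemma Gamma_gt0 (R : realType) (p : R) : 0 < p -> 0 < Gamma p.
Proof.
move=> p0.
pose g (t : R) : R := t `^ (p - 1) * expR (- t).
have g0 t : 0 <= g t by rewrite mulr_ge0 ?powR_ge0 ?expR_ge0.
have mg : measurable_fun setT g.
  apply: measurable_funM; first exact: measurable_powR.
  by apply: measurableT_comp => //; exact: measurable_expR.
have mgE (D : set (measurableTypeR R)) : measurable D -> measurable_fun D (EFin \o g).
  by move=> mD; apply/measurable_EFinP; exact: measurable_funTS.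
pose I : \bar R := (\int[@lebesgue_measure R]_(t in `]0%R, +oo[) (g t)%:E)%E.
have I0 : (0 <= I)%E by apply: integral_ge0 => t _; rewrite lee_fin.
pose n := Num.truncn (2 * p); pose K : R := 4 * (n.+1)`!%:R.
have K0 : 0 < K by rewrite mulr_gt0// ltr0n fact_gt0.
(* (1 + t^p)^2 is at most a constant times e^t because 2p <= n + 1. *)
have gK (t : R) : 0 < t ->
    g t <= K / p * (p * t `^ (p - 1) * (1 + t `^ p) ^- 2).
  move=> t0.
  have le1 : 1 <= (n.+1)`!%:R * expR t.
    have := @powR_le_fact_expR R 0 t n (lexx _) (ler0n _ _) t0.
    by rewrite powRr0.
  have pn : 2 * p <= n.+1%:R by rewrite ltW// truncnS_gt.
  have le2 : t `^ p <= (n.+1)`!%:R * expR t.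
    by apply: powR_le_fact_expR; rewrite ?ltW//; lra.
  have le3 : (t `^ p) ^+ 2 <= (n.+1)`!%:R * expR t.
    rewrite -powR_mulrn ?powR_ge0// -powRrM mulrC.
    by apply: powR_le_fact_expR => //; lra.
  have le4 : (1 + t `^ p) ^+ 2 <= K * expR t.
    by rewrite sqrrD expr1n mul1r /K -mulrA mulr2n; lra.
  rewrite /g expRN.
  rewrite (_ : K / p * _ = t `^ (p - 1) * (K / (1 + t `^ p) ^+ 2)); last first.
    by field; rewrite !gt_eqF// ltr_pwDl// powR_ge0.
  rewrite ler_wpM2l ?powR_ge0// ler_pdivlMr; last first.
    by rewrite exprn_gt0// ltr_pwDl// powR_ge0.
  by rewrite mulrC ler_pdivrMr ?expR_gt0.
have Ifin : (I <= (K / p)%:E)%E.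
  (* The half-line is exhausted by segments that avoid the singularity at 0. *)
  pose F k : set (measurableTypeR R) := `[k.+1%:R^-1, k.+2%:R]%classic.
  have F_pos k x : F k x -> 0 < x.
    by rewrite /F/= in_itv/= => /andP[+ _]; apply: lt_le_trans; rewrite invr_gt0.
  have mF k : measurable (F k) by rewrite /F; exact: measurable_itv.
  have FE : `]0, +oo[%classic = \bigcup_k F k.
    apply/seteqP; split=> [x|x [k _ /F_pos]]; rewrite /= in_itv/= andbT// => x0.
    exists (Num.truncn (x + x^-1)) => //; rewrite /F/= in_itv/=.
    have := truncnS_gt (x + x^-1); set m := Num.truncn _ => xm.
    have xi0 : 0 < x^-1 by rewrite invr_gt0.
    apply/andP; split.
      by rewrite -[leRHS]invrK lef_pV2 ?posrE ?invr_gt0//; lra.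
    by rewrite -[m.+2%:R]natr1; lra.
  have ndF : {homo F : k m / (k <= m)%N >-> (k <= m)%O}.
    move=> k m km; apply/subsetPset => x; rewrite /F/= !in_itv/= => /andP[kx xk].
    apply/andP; split; last by apply: le_trans xk _; rewrite ler_nat !ltnS.
    by apply: le_trans kx; rewrite lef_pV2 ?posrE ?ltr0n// ler_nat ltnS.
  have cvgI : (\int[@lebesgue_measure R]_(x in F i) (g x)%:E)%E @[i --> \oo] -->
      (\int[@lebesgue_measure R]_(x in \bigcup_i F i) (g x)%:E)%E.
    apply: ge0_nondecreasing_set_cvg_integral => //.
    - by move=> i; exact: (mgE _ (mF i)).
    - by move=> i x _; rewrite lee_fin.
  rewrite /I FE -(cvg_lim _ cvgI)//.
  apply: lime_le; first by apply/cvg_ex; eexists; exact: cvgI.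
  apply: nearW => k.
  have ik : k.+1%:R^-1 < k.+2%:R :> R.
    apply: (@le_lt_trans _ _ 1); last by rewrite ltr1n.
    by rewrite invf_le1// ler1n.
  have := integral_powR_rational_le p0 _ ik; rewrite invr_gt0 ltr0n => /(_ isT) le1.
  pose h (t : R) := p * t `^ (p - 1) * (1 + t `^ p) ^- 2.
  have h0 t : 0 <= h t.
    by rewrite !mulr_ge0 ?powR_ge0 ?invr_ge0 ?sqr_ge0// ltW.
  have mh : measurable_fun setT h.
    apply: measurable_funM.
      by apply: measurable_funM => //; exact: measurable_powR.
    rewrite (_ : (fun t => _) = (fun x : R => x `^ (- 2%:R)) \o (fun t => 1 + t `^ p)).
      apply: measurableT_comp; first exact: measurable_powR.
      by apply: measurable_funD => //; exact: measurable_powR.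
    apply/funext => t /=; rewrite powRN powR_mulrn//.
    by rewrite addr_ge0 ?powR_ge0.
  have mhE (D : set (measurableTypeR R)) : measurable D -> measurable_fun D (EFin \o h).
    by move=> mD; apply/measurable_EFinP; exact: measurable_funTS.
  apply: (@le_trans _ _ (\int[@lebesgue_measure R]_(t in F k) ((K / p)%:E * (h t)%:E))%E).
    apply: ge0_le_integral => //.
    - by move=> x _; rewrite lee_fin.
    - exact: (mgE _ (mF k)).
    - by apply: measurable_funeM; exact: (mhE _ (mF k)).
    - by move=> x /F_pos /gK; rewrite -EFinM lee_fin.
  rewrite ge0_integralZl_EFin//; last 3 first.
  - by move=> x _; rewrite lee_fin.
  - exact: (mhE _ (mF k)).
  - by rewrite divr_ge0 ?ltW.
  rewrite -[leRHS]mule1 lee_wpmul2l// lee_fin divr_ge0 ?ltW//.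
have Ine0 : I != 0%E.
  apply/eqP => I_0.
  have mD : measurable (`]0%R, +oo[ : set (measurableTypeR R)) by exact: measurable_itv.
  have [+ _] := ae_eq_integral_abs (@lebesgue_measure R) mD (mgE _ mD).
  have -> : (\int[@lebesgue_measure R]_(t in `]0%R, +oo[) `|(EFin \o g) t| = 0)%E.
    by rewrite -I_0; apply: eq_integral => t _; rewrite /= ger0_norm.
  move=> /(_ erefl)[A [mA A0 sub]].
  have : ((@lebesgue_measure R) `]0%R, +oo[%classic <= (@lebesgue_measure R) A)%E.
    apply: le_measure; rewrite ?inE//.
    move=> t t0; apply: sub => /= /(_ t0)[] /eqP; apply/negP.
    move: t0; rewrite /= in_itv/= andbT => t0.
    by rewrite mulf_neq0 ?lt0r_neq0 ?powR_gt0 ?expR_gt0.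
  by rewrite A0 lebesgue_measure_itv/= ltry.
rewrite /Gamma /Rintegral fine_gt0// lt0e Ine0 I0/=.
exact: le_lt_trans Ifin (ltry _).
Qed.

(** * Smooth bounded approximations of a step *)

Lemma antiderivative_increment (R : realType) (f F : R -> R) :
  (forall x : R, is_derive x 1 F (f x)) -> {homo f : x y / x <= y} ->
  forall x y, x <= y -> f x * (y - x) <= F y - F x <= f y * (y - x).
Proof.
move=> dF f_nd x y xy.
have [|c] := @MVT_segment R F f x y xy (fun z _ => dF z).
  by apply: derivable_within_continuous => z _; case: (dF z).
rewrite in_itv/= => /andP[xc cy] ->.
by rewrite !ler_wpM2r ?subr_ge0 ?f_nd.
Qed.

Section logistic.
Variables (R : realType) (K c : R).

Definition logistic (x : R) : R := 1 - (1 + expR (K * (x - c)))^-1.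

Let e (x : R) : R := expR (K * (x - c)).

Let e1_gt0 x : 0 < 1 + e x.
Proof. by rewrite ltr_pwDl// expR_ge0. Qed.

Let is_derive_e1 (x : R) : is_derive x 1 (fun y : R => 1 + e y) (K * e x).
Proof.
have daff : is_derive x 1 (fun y : R => K * (y - c)) K.
  rewrite -[X in is_derive _ _ _ X]mulr1 -[X in K * X]subr0.
  exact: is_deriveZ.
have dexp := @is_derive1_comp R expR (fun y => K * (y - c)) x _ _
    (is_derive_expR _) daff.
rewrite mulrC -[X in is_derive _ _ _ X]add0r.
exact: is_deriveD.
Qed.

Lemma logistic_itv x : 0 < logistic x < 1.
Proof.
rewrite /logistic subr_gt0 gtrBl invr_gt0 ltr_pwDl ?expR_ge0// andbT.
by rewrite invf_lt1 ?ltrDl ?expR_gt0// ltr_pwDl ?expR_ge0.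
Qed.

Lemma is_derive_logistic (x : R) :
  is_derive x 1 logistic (K * (logistic x * (1 - logistic x))).
Proof.
have d1 := @is_deriveV _ (fun y : R => 1 + e y) _ _ _ (lt0r_neq0 (e1_gt0 x)) (is_derive_e1 x).
rewrite (_ : K * _ = 0 - (- (1 + e x) ^- 2 *: (K * e x))); last first.
  rewrite sub0r scaleNr opprK /logistic -/(e x) /GRing.scale/=.
  by field; rewrite gt_eqF.
exact: is_deriveB.
Qed.

(** The logistic function y solves y' = K y (1 - y), so its iterated
    derivatives are polynomials in y. *)
Lemma derivable_derive1n_logistic n (x : R) : derivable (derive1n n logistic) x 1.
Proof.
suff [P ->] : exists P : {poly R}, derive1n n logistic = horner P \o logistic.
  by case: (is_derive1_comp (is_derive_poly P (logistic x)) (is_derive_logistic x)).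
elim: n => [|n [P IH]].
  by exists 'X%R; apply/funext => y; rewrite /= hornerX.
exists (P^`() * (K%:P * ('X * (1 - 'X))))%R; apply/funext => y.
rewrite derive1nS IH derive1E.
have [_ ->] := is_derive1_comp (is_derive_poly P (logistic y)) (is_derive_logistic y).
by rewrite /= !hornerE.
Qed.

Lemma logistic_nondecreasing : 0 <= K -> {homo logistic : x y / x <= y}.
Proof.
move=> K0 x y xy; rewrite /logistic lerD2l lerN2 lef_pV2 ?posrE//.
by rewrite lerD2l ler_expR ler_wpM2l// lerD2r.
Qed.

Definition softplus (x : R) : R := K^-1 * ln (1 + expR (K * (x - c))).

Lemma is_derive_softplus (x : R) : K != 0 -> is_derive x 1 softplus (logistic x).
Proof.
move=> K0.
have d1 := @is_derive1_comp R (@ln R) (fun y => 1 + e y) x _ _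
    (is_derive1_ln (e1_gt0 x)) (is_derive_e1 x).
rewrite (_ : logistic x = K^-1 *: ((1 + e x)^-1 * (K * e x))); last first.
  by rewrite /logistic -/(e x) /GRing.scale/=; field; rewrite K0 gt_eqF.
exact: is_deriveZ.
Qed.

End logistic.

(** The logistic function centred midway between l1 and l2 and steep enough to
    lie within delta of 0 at l1 and of 1 at l2.  From G = x f - F one gets
    G y - G x >= x (f y - f x), whence the monotonicity of G on the positive
    half-line and its jump across [l1, l2]. *)
Lemma approximate_step (R : realType) (l1 l2 delta : R) :
  0 < l1 -> l1 < l2 -> 0 < delta ->
  exists f F G : R -> R, [/\ energy_nonlinearity f F G,
    forall x, 0 <= x -> F x <= Num.max (x - l1) 0 + delta * x,
    forall x, 0 <= x -> 0 <= F x /\ (1 - delta) * Num.max (x - l2) 0 <= F x,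
    forall x y, 0 <= x -> x <= y -> G x <= G y &
    forall x y, 0 <= x -> x <= l1 -> l2 <= y -> l1 * (1 - 2 * delta) <= G y - G x].
Proof.
move=> l10 l12 d0.
pose c := (l1 + l2) / 2; pose K := 2 / ((l2 - l1) * delta).
have l21 : 0 < l2 - l1 by rewrite subr_gt0.
have K0 : 0 < K by rewrite divr_gt0// mulr_gt0.
pose f := logistic K c; pose F x := softplus K c x - softplus K c 0.
pose G x := x * f x - F x.
have f_nd : {homo f : x y / x <= y} by apply: logistic_nondecreasing; exact: ltW.
have f_itv x : 0 < f x < 1 by exact: logistic_itv.
have dF (x : R) : is_derive x 1 F (f x).
  rewrite -[X in is_derive _ _ _ X]subr0.
  by apply: is_deriveB; apply: is_derive_softplus; rewrite gt_eqF.
have F0 : F 0 = 0 by rewrite /F subrr.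
have Fc := antiderivative_increment dF f_nd.
have F_ge0 x : 0 <= x -> 0 <= F x.
  move=> x0; have /andP[+ _] := Fc _ _ x0; rewrite F0 !subr0; apply: le_trans.
  by rewrite mulr_ge0//; have /andP[/ltW] := f_itv 0.
have Ge x y : x <= y -> x * (f y - f x) <= G y - G x.
  by move=> xy; have /andP[_] := Fc _ _ xy; rewrite /G; lra.
(* At l1 and l2 the argument K (x - c) is -1/delta and 1/delta. *)
have exp_big : delta^-1 < 1 + expR delta^-1.
  by have := expR_ge1Dx delta^-1; lra.
have fl1 : f l1 <= delta.
  rewrite /f /logistic (_ : K * (l1 - c) = - delta^-1); last first.
    by rewrite /K /c; field; rewrite !gt_eqF.
  have epos := expR_gt0 delta^-1.
  rewrite expRN (_ : 1 - _ = (1 + expR delta^-1)^-1); last first.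
    by field; rewrite !gt_eqF// ?addr_gt0// invr_gt0.
  by rewrite -[leRHS]invrK lef_pV2 ?posrE ?invr_gt0 ?addr_gt0// ltW.
have fl2 : 1 - delta <= f l2.
  rewrite /f /logistic (_ : K * (l2 - c) = delta^-1); last first.
    by rewrite /K /c; field; rewrite !gt_eqF.
  have epos := expR_gt0 delta^-1.
  by rewrite lerD2l lerN2 -[leRHS]invrK lef_pV2 ?posrE ?invr_gt0 ?addr_gt0// ltW.
exists f, F, G; split.
- split.
  + by move=> n x; exact: derivable_derive1n_logistic.
  + by exists 1 => x; have /andP[? ?] := f_itv x; rewrite gtr0_norm// ltW.
  + by [].
  + split; first by rewrite /G mul0r F0 subrr.
    move=> x; have df := is_derive_logistic K c x.
    rewrite derive1E (_ : 'D_1 f x = K * (f x * (1 - f x))); last by case: df.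
    have dxf := is_deriveM (is_derive_id x 1) df.
    have := is_deriveB dxf (dF x).
    rewrite (_ : _ - f x = x * (K * (f x * (1 - f x))))//.
    by rewrite /GRing.scale/= mulr1 addrK.
- move=> x x0; have [xl1|l1x] := leP x l1.
    rewrite max_r ?subr_le0// add0r.
    have /andP[_] := Fc _ _ x0; rewrite F0 !subr0 => /le_trans; apply.
    by rewrite ler_wpM2r// (le_trans _ fl1)// f_nd.
  rewrite max_l ?subr_ge0 ?(ltW l1x)//.
  have /andP[_ h1] := Fc _ _ (ltW l10).
  have /andP[_ h2] := Fc _ _ (ltW l1x).
  have h3 : f l1 * l1 <= delta * x 
    by rewrite ler_pM ?(ltW l10) ?(ltW l1x)//; have /andP[/ltW] := f_itv l1.
  have h4 : f x * (x - l1) <= x - l1.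
    by rewrite ler_piMl ?subr_ge0 ?(ltW l1x)//; have /andP[_ /ltW] := f_itv x.
  by lra.
- move=> x x0; split; first exact: F_ge0.
  have [xl2|l2x] := leP x l2; first by rewrite max_r ?subr_le0// mulr0 F_ge0.
  rewrite max_l ?subr_ge0 ?(ltW l2x)//.
  have /andP[h1 _] := Fc _ _ (ltW l2x).
  have h2 : (1 - delta) * (x - l2) <= f l2 * (x - l2).
    by rewrite ler_wpM2r// subr_ge0 ltW.
  have := F_ge0 _ (ltW (lt_trans l10 l12)); lra.
- move=> x y x0 xy; rewrite -subr_ge0; apply: le_trans (Ge _ _ xy).
  by rewrite mulr_ge0// subr_ge0 f_nd.
- move=> x y x0 xl1 l2y.
  have G_nd a b : 0 <= a -> a <= b -> G a <= G b.
    move=> a0 ab; rewrite -subr_ge0; apply: le_trans (Ge _ _ ab).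
    by rewrite mulr_ge0// subr_ge0 f_nd.
  have h1 := G_nd _ _ x0 xl1.
  have h2 := G_nd _ _ (ltW (lt_trans l10 l12)) l2y.
  have h3 := Ge _ _ (ltW l12).
  have h4 : l1 * (1 - 2 * delta) <= l1 * (f l2 - f l1).
    by rewrite ler_pM2l//; lra.
  by lra.
Qed.

(** * Lower bound for the bilinear form *)

Section cubes.
Context (R : realType).

(** Balls of the sup norm, whose Lebesgue measure factorizes over the
    coordinates. *)
Definition cube n (x : 'rV[R]_n) (rho : R) : set 'rV[R]_n :=
  [set y | forall i, `|x ord0 i - y ord0 i| < rho].

Lemma measurable_cube n (x : 'rV[R]_n) rho : measurable (cube x rho).
Proof.
rewrite (_ : cube x rho = \bigcap_(i in [set: 'I_n])
    [set y | `|x ord0 i - coord_rV i y| < rho]); last first.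
  by apply/seteqP; split=> y h i; [move=> _|]; apply: h.
apply: fin_bigcap_measurable => // i _.
rewrite -[X in measurable X]setTI.
have mf : measurable_fun [set: 'rV[R]_n] (fun y => `|x ord0 i - coord_rV i y|).
  apply: measurableT_comp => //; apply: measurable_funB => //.
  exact: measurable_coord_rV.
rewrite (_ : [set _ | _] = (fun y => `|x ord0 i - coord_rV i y|) @^-1` `]-oo, rho[).
  by apply: mf => //; exact: measurable_itv.
by apply/seteqP; split=> y; rewrite /= in_itv.
Qed.

Lemma leb_cube n (x : 'rV[R]_n) rho : 0 < rho ->
  leb R n (cube x rho) = ((2 * rho) ^+ n)%:E.
Proof.
move=> rho0; elim: n x => [|n IH] x.
  by rewrite /= diracE mem_set// => -[].
rewrite /= /leb_step /pushforward.
rewrite (_ : _ @^-1` _ = `](x ord0 ord0 - rho), (x ord0 ord0 + rho)[ `*`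
    cube (\row_j x ord0 (lift ord0 j)) rho); last first.
  apply/seteqP; split => -[a y]; rewrite /cube/= in_itv/=.
    move=> h; split.
      have := h ord0; rewrite mxE unlift_none/= ltr_norml; lra.
    by move=> j; have := h (lift ord0 j); rewrite !mxE liftK.
  move=> [a_itv h] i; rewrite mxE; case: unliftP => [j|] ->/=.
    by have := h j; rewrite mxE.
  by rewrite ltr_norml; move: a_itv; lra.
rewrite product_measure1E; last 2 first.
- exact: measurable_itv.
- exact: measurable_cube.
rewrite [X in (_ * X)%E](IH _) [X in (X * _)%E]lebesgue_measure_itv/= lte_fin.
rewrite ifT; last by lra.
rewrite -EFinB -EFinM exprS; congr (_ * _)%:E; lra.
Qed.

Lemma enorm_ge0 n (z : 'rV[R]_n) : 0 <= enorm z.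
Proof. exact: sqrtr_ge0. Qed.

Lemma enorm_gt0 n (z : 'rV[R]_n) : z != 0 -> 0 < enorm z.
Proof.
move=> z0; rewrite sqrtr_gt0 lt0r; apply/andP; split; last first.
  by apply: sumr_ge0 => i _; rewrite -expr2 sqr_ge0.
apply: contra z0 => /eqP d0; apply/eqP/rowP => i; rewrite mxE.
have zz_ge0 (j : 'I_n) : true -> 0 <= z ord0 j * z ord0 j.
  by move=> _; rewrite -expr2 sqr_ge0.
have /eqP := @psumr_eq0P _ _ _ _ zz_ge0 d0 i isT.
by rewrite mulf_eq0 orbb => /eqP.
Qed.

Lemma enorm_le n (z : 'rV[R]_n) rho : 0 <= rho ->
  (forall i, `|z ord0 i| <= rho) -> enorm z <= Num.sqrt n%:R * rho.
Proof.
move=> rho0 zrho.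
have -> : Num.sqrt n%:R * rho = Num.sqrt (n%:R * rho ^+ 2).
  by rewrite sqrtrM ?ler0n// sqrtr_sqr ger0_norm.
rewrite ler_wsqrtr// /dot.
apply: (@le_trans _ _ (\sum_(i < n) rho ^+ 2)).
  apply: ler_sum => i _; rewrite -expr2 -[leLHS]real_normK ?num_real//.
  by rewrite lerXn2r ?nnegrE.
by rewrite sumr_const card_ord mulr_natl.
Qed.

End cubes.

Lemma powR_natX (R : realType) (x y : R) (n : nat) : (x `^ y) ^+ n = x `^ (y * n%:R).
Proof. by rewrite powRrM powR_mulrn ?powR_ge0. Qed.

(** With q = N + 2r, the kernel |x - y|^(-q) on a cube of volume 2V around x is
    at least (sqrt N * rho)^(-q); times the volume V this is a multiple of
    V^(1 - q/N) = V^(-2r/N). *)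
Lemma cube_side (R : realType) (N : nat) (q : R) : (0 < N)%N ->
  exists2 K : R, 0 < K & forall V : R, 0 < V ->
    exists rho : R, [/\ 0 < rho, (2 * rho) ^+ N = 2 * V &
      (Num.sqrt N%:R * rho) `^ (- q) * V = K * V `^ (1 - q / N%:R)].
Proof.
move=> N0; have n0 : 0 < N%:R :> R by rewrite ltr0n.
have sN : 0 < Num.sqrt N%:R / 2 :> R by rewrite divr_gt0// sqrtr_gt0.
exists ((Num.sqrt N%:R / 2) `^ (- q) * 2 `^ (- q / N%:R)).
  by rewrite mulr_gt0// powR_gt0.
move=> V V0; have V20 : 0 < 2 * V by rewrite mulr_gt0.
exists ((2 * V) `^ N%:R^-1 / 2); split.
- by rewrite divr_gt0// powR_gt0.
- rewrite mulrCA divff// mulr1 powR_natX mulVf ?gt_eqF// powRr1// ltW//.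
- rewrite (_ : _ * (_ / 2) = Num.sqrt N%:R / 2 * (2 * V) `^ N%:R^-1); last by field.
  rewrite (@powRM _ (_ / 2)) ?powR_ge0 ?(ltW sN)// -powRrM.
  rewrite [_^-1 * - q]mulrC.
  rewrite powRM ?(ltW V0)// -!mulrA; congr (_ * (_ * _)).
  rewrite -{2}[V]powRr1 ?(ltW V0)// -powRD; last first.
    by apply/implyP => _; rewrite gt_eqF.
  by rewrite mulNr addrC.
Qed.

(** Comparison almost everywhere is the form in which nonnegativity of the
    solution can be used: it holds at each time off a negligible set. *)
Lemma le_integral_ae d (T : measurableType d) (R : realType)
    (mu : {measure set T -> \bar R}) (D : set T) (f g : T -> \bar R) :
  measurable D -> (forall x, D x -> 0 <= f x)%E ->
  measurable_fun D f -> measurable_fun D g ->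
  {ae mu, forall x, D x -> f x <= g x}%E ->
  (\int[mu]_(x in D) f x <= \int[mu]_(x in D) g x)%E.
Proof.
move=> mD f0 mf mg fg.
rewrite (@ae_eq_integral _ _ _ mu D (abse \o g) g)//; last 2 first.
- exact: measurableT_comp.
- apply: filterS fg => x fgx Dx /=; rewrite gee0_abs//.
  exact: le_trans (f0 x Dx) (fgx Dx).
apply: ae_ge0_le_integral => //.
- by move=> x _; exact: abse_ge0.
- exact: measurableT_comp.
- by apply: filterS fg => x fgx Dx; apply: le_trans (fgx Dx) (lee_abs _).
Qed.

Lemma le_Rintegral_ae d (T : measurableType d) (R : realType)
    (mu : {measure set T -> \bar R}) (D : set T) (f g : T -> R) :
  measurable D -> mu.-integrable D (EFin \o f) -> mu.-integrable D (EFin \o g) ->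
  {ae mu, forall x, D x -> f x <= g x} ->
  \int[mu]_(x in D) f x <= \int[mu]_(x in D) g x.
Proof.
move=> mD fi gi fg.
have mf : measurable_fun D f by apply/measurable_EFinP; case/integrableP : fi.
have mg : measurable_fun D g by apply/measurable_EFinP; case/integrableP : gi.
have mm : measurable_fun D (EFin \o (fun x => Num.min (f x) (g x))).
  by apply/measurable_EFinP; exact: measurable_minr.
have fE : ae_eq mu D (EFin \o (fun x => Num.min (f x) (g x))) (EFin \o f).
  by apply: filterS fg => x fgx Dx; rewrite /= min_l// fgx.
have intE : (\int[mu]_(x in D) (Num.min (f x) (g x))%:E = \int[mu]_(x in D) (f x)%:E)%E.
  by apply: ae_eq_integral => //; apply/measurable_EFinP.
rewrite {1}/Rintegral -intE; apply: le_Rintegral => //; last first.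
  by move=> x _; rewrite ge_min lexx orbT.
have fgi : mu.-integrable D (fun x => (`|f x| + `|g x|)%:E).
  under eq_fun do rewrite EFinD.
  by apply: integrableD => //; [exact: integrable_norm|exact: integrable_norm].
apply: le_integrable (fgi) => // x _; rewrite /= lee_fin [leRHS]ger0_norm ?addr_ge0//.
by rewrite /Num.min; case: ifP => _; rewrite ?lerDl ?lerDr.
Qed.

(** The bilinear form sees the interaction between a point x above the level l2
    and the points y of a cube around x that lie below l1; the latter fill a
    volume at least V when {u > l1} has volume at most V and the cube has
    volume 2V. *)
Section truncated_bilinear_bound.
Context (R : realType) (N : nat) (s : R).
Hypothesis hN : (0 < N)%N.

Variables (u : 'rV[R]_N -> R) (G : R -> R) (l1 l2 kappa rho V : R).
Hypothesis int_u : (leb R N).-integrable setT (EFin \o u).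
Hypothesis u_ge0 : {ae leb R N, forall x, 0 <= u x}.
Hypothesis int_bilin : (leb R N \x leb R N)%E.-integrable setT
  (EFin \o bilin_integrand s (fun x => G (u x)) u).
Hypothesis G_nd : forall x y, 0 <= x -> x <= y -> G x <= G y.
Hypothesis l12 : l1 < l2.
Hypothesis kappa_ge0 : 0 <= kappa.
Hypothesis G_jump : forall x y, 0 <= x -> x <= l1 -> l2 <= y -> kappa <= G y - G x.
Hypothesis rho_gt0 : 0 < rho.
Hypothesis hs1 : s < 1.
Hypothesis volV : (2 * rho) ^+ N = 2 * V.
Hypothesis superV : (leb R N [set x | (l1 < u x)%R] <= V%:E)%E.

Let q : R := N%:R + 2 * (1 - s).
Let k0 : R := (Num.sqrt N%:R * rho) `^ (- q).
Let D (x : 'rV[R]_N) := cube x rho `\` [set y | l1 < u y].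

Let mu_ : measurable_fun setT u.
Proof. by have /integrableP[/measurable_EFinP] := int_u. Qed.

Let m_super : measurable [set y | l1 < u y].
Proof.
rewrite (_ : [set y | _] = setT `&` u @^-1` `]l1, +oo[).
  by apply: mu_ => //; exact: measurable_itv.
by apply/seteqP; split => y; rewrite /= in_itv/= andbT; [|case].
Qed.

Let mD x : measurable (D x).
Proof. by apply: measurableD => //; exact: measurable_cube. Qed.

Let D_ge x : (V%:E <= leb R N (D x))%E.
Proof.
have : (leb R N (cube x rho) <= leb R N (D x) + leb R N [set y | (l1 < u y)%R])%E.
  apply: le_trans (measureU2 _ _ _); [|exact: mD|exact: m_super].
  apply: le_measure; rewrite ?inE.
  - exact: measurable_cube.
  - by apply: measurableU; [exact: mD|exact: m_super].
  - by move=> y xy; have [ly|ly] := pselect (l1 < u y); [right|left].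
rewrite leb_cube// volV => h.
have := le_trans h (leeD2l _ superV).
have : (0 <= leb R N (D x))%E by [].
case: (leb R N (D x)) => [r _| _ _|]; [|exact: leey|by []].
by rewrite -EFinD !lee_fin; lra.
Qed.

Let I := bilin_integrand s (fun x => G (u x)) u.

Let q0 : 0 < q.
Proof. by rewrite /q addr_gt0 ?ltr0n ?mulr_gt0 ?subr_gt0. Qed.

Let I_ge0 x y : 0 <= u x -> 0 <= u y -> 0 <= I (x, y).
Proof.
move=> ux uy; rewrite /I /bilin_integrand/= divr_ge0 ?powR_ge0//.
have [xy|/ltW yx] := leP (u x) (u y).
  by rewrite mulr_le0 ?subr_le0 ?G_nd//.
by rewrite mulr_ge0 ?subr_ge0 ?G_nd//.
Qed.

Let k0_gt0 : 0 < k0.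
Proof. by rewrite powR_gt0// mulr_gt0// sqrtr_gt0 ltr0n. Qed.

Let I_ge x y : 0 <= u x -> 0 <= u y ->
  kappa * k0 * Num.max (u x - l2) 0 * \1_(D x) y <= I (x, y).
Proof.
move=> ux uy; rewrite indicE; case: (boolP (y \in D x)) => [|_]; last first.
  by rewrite mulr0 I_ge0.
rewrite inE => -[xy /negP]; rewrite -leNgt => uyl1; rewrite mulr1.
have [uxl2|l2ux] := leP (u x) l2.
  by rewrite max_r ?subr_le0// mulr0 I_ge0.
rewrite max_l ?subr_ge0 ?(ltW l2ux)// /I /bilin_integrand/= -/q.
(* The kernel vanishes on the diagonal, where u x = u y cannot be both above l2
   and below l1. *)
have xy0 : x - y != 0.
  by rewrite subr_eq0; apply/eqP => xyE; move: l2ux uyl1 l12; rewrite xyE; lra.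
have k0_le : k0 <= (enorm (x - y) `^ q)^-1.
  rewrite /k0 powRN lef_pV2 ?posrE ?powR_gt0 ?enorm_gt0//; last first.
    by rewrite mulr_gt0// sqrtr_gt0 ltr0n.
  rewrite ge0_ler_powR ?nnegrE ?enorm_ge0 ?(ltW q0)//.
    by rewrite mulr_ge0 ?sqrtr_ge0 ?ltW.
  by apply: enorm_le => [|i]; [exact: ltW|rewrite !mxE ltW].
rewrite mulrAC ler_pM// ?mulr_ge0 ?(ltW k0_gt0) ?subr_ge0 ?(ltW l2ux)//.
apply: ler_pM => //; rewrite ?subr_ge0 ?(ltW l2ux)//.
  by apply: G_jump => //; exact: ltW.
by rewrite lerD2l lerN2 (le_trans uyl1)// ltW.
Qed.

(** The integrand is integrable by assumption, so that Fubini's theorem applies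
    before anything is known about its sign; it is then nonnegative for almost
    all x and, x being fixed, for almost all y. *)
Lemma bilin_ge_excess :
  ((kappa * k0 * V)%:E * \int[leb R N]_x (Num.max (u x - l2) 0)%:E <=
   \int[(leb R N \x leb R N)%E]_z (I z)%:E)%E.
Proof.
have m_max : measurable_fun setT (fun x => Num.max (u x - l2) 0).
  by apply: measurable_maxr => //; exact: measurable_funB.
have max_ge0 x : 0 <= Num.max (u x - l2) 0 by rewrite le_max lexx orbT.
have V0 : 0 <= V.
  have : 0 <= (2 * rho) ^+ N by rewrite exprn_ge0// mulr_ge0// ltW.
  by rewrite volV; lra.
have kk0 : 0 <= kappa * k0 by rewrite mulr_ge0// ltW.
have mI : measurable_fun setT (EFin \o I) by case/integrableP : int_bilin.
have inner x : 0 <= u x ->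
    ((kappa * k0 * V * Num.max (u x - l2) 0)%:E <=
      fubini_F (leb R N) (EFin \o I) x)%E.
  move=> ux.
  apply: (@le_trans _ _ (\int[leb R N]_y
      (kappa * k0 * Num.max (u x - l2) 0 * \1_(D x) y)%:E)%E).
    under eq_integral do rewrite EFinM.
    rewrite ge0_integralZl_EFin//; last 2 first.

    - by apply/measurable_EFinP; exact: measurable_indic.
    - by rewrite mulr_ge0.
    rewrite integral_indic// setIT mulrAC EFinM lee_wpmul2l ?D_ge//.
    by rewrite lee_fin mulr_ge0.
  apply: le_integral_ae => //.
  - by move=> y _; rewrite lee_fin !mulr_ge0// ltW.
  - apply/measurable_EFinP; apply: measurable_funM; first exact: measurable_cst.
    exact: measurable_indic.
  - exact: measurableT_comp mI (pair1_measurable x).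
  - by apply: filterS u_ge0 => y uy _; rewrite lee_fin I_ge.
rewrite -(integral12_prod_meas1 int_bilin).
rewrite -ge0_integralZl_EFin//; last 3 first.
- by move=> x _; rewrite lee_fin.
- exact/measurable_EFinP.
- by rewrite mulr_ge0.
apply: le_integral_ae => //.
- by move=> x _; rewrite -EFinM lee_fin mulr_ge0// mulr_ge0.
- apply: measurable_funeM.
  exact/measurable_EFinP.
- exact: (measurable_fubini_F int_bilin).
- by apply: filterS u_ge0 => x ux _; rewrite -EFinM; exact: inner.
Qed.

End truncated_bilinear_bound.

(** * The mass above a level *)

Section excess.
Context (R : realType) (N : nat).
Implicit Types (w : 'rV[R]_N -> R).

Definition excess (l : R) w : R := \int[leb R N]_x Num.max (w x - l) 0.

Lemma integrable_excess l w : 0 <= l -> (leb R N).-integrable setT (EFin \o w) ->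
  (leb R N).-integrable setT (fun x => (Num.max (w x - l) 0)%:E).
Proof.
move=> l0 iw; apply: le_integrable (iw) => //.
  apply/measurable_EFinP; apply: measurable_maxr => //; apply: measurable_funB => //.
  by apply/measurable_EFinP; case/integrableP : iw.
move=> x _; rewrite /= lee_fin ger0_norm ?le_max ?lexx ?orbT//.
by rewrite ge_max normr_ge0 andbT (le_trans _ (ler_norm _))// gerBl.
Qed.

Lemma excess_EFin l w : 0 <= l -> (leb R N).-integrable setT (EFin \o w) ->
  (excess l w)%:E = (\int[leb R N]_x (Num.max (w x - l) 0)%:E)%E.
Proof.
move=> l0 iw; rewrite /excess /Rintegral fineK//.
by apply: integrable_fin_num => //; exact: integrable_excess.
Qed.

Lemma excess_ge0 l w : 0 <= excess l w.
Proof. by apply: Rintegral_ge0 => x _; rewrite le_max lexx orbT. Qed.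

Lemma le_excess l1 l2 w : 0 <= l1 -> l1 <= l2 ->
  (leb R N).-integrable setT (EFin \o w) -> excess l2 w <= excess l1 w.
Proof.
move=> l10 l12 iw; apply: le_Rintegral => //.
- by apply: integrable_excess => //; exact: le_trans l12.
- exact: integrable_excess.
- by move=> x _; rewrite ge_max !le_max lexx orbT andbT lerD2l lerN2 l12.
Qed.

(** Chebyshev's inequality: w - l1 exceeds l2 - l1 where w > l2. *)
Lemma markov_excess l1 l2 w (V : R) : 0 <= l1 -> l1 < l2 ->
  (leb R N).-integrable setT (EFin \o w) ->
  excess l1 w <= (l2 - l1) * V -> (leb R N [set x | (l2 < w x)%R] <= V%:E)%E.
Proof.
move=> l10 l12 iw hV; have l210 : 0 < l2 - l1 by rewrite subr_gt0.
have mw : measurable_fun setT w by apply/measurable_EFinP; case/integrableP : iw.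
have mS : measurable [set x | l2 < w x].
  rewrite (_ : [set x | _] = setT `&` w @^-1` `]l2, +oo[).
    by apply: mw => //; exact: measurable_itv.
  by apply/seteqP; split => y; rewrite /= in_itv/= andbT; [|case].
rewrite -(@lee_pmul2l _ (l2 - l1)%:E)//.
rewrite -EFinM; apply: le_trans (_ : (excess l1 w)%:E <= _)%E; last by rewrite lee_fin.
rewrite excess_EFin// -(setIT [set x | _]) -integral_indic//.
rewrite -ge0_integralZl_EFin//; last 2 first.
- by apply/measurable_EFinP; exact: measurable_indic.
- exact: ltW.
apply: ge0_le_integral => //.
- by move=> x _; rewrite -EFinM lee_fin mulr_ge0// ltW.
- by apply: measurable_funeM; apply/measurable_EFinP; exact: measurable_indic.
- by case/integrableP : (integrable_excess l10 iw).
- move=> x _; rewrite -EFinM lee_fin indicE.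
  case: (boolP (x \in _)) => [|_]; last by rewrite mulr0 le_max lexx orbT.
  by rewrite inE/= => l2w; rewrite mulr1 le_max lerD2r (ltW l2w).
Qed.

End excess.

(** * De Giorgi iteration *)

(** Removes the parameter delta of the approximate step. *)
Lemma le_of_le_add_small (R : realType) (a b k : R) :
  0 <= k -> (forall delta, 0 < delta -> delta <= 2^-1 -> a <= b + delta * k) ->
  a <= b.
Proof.
move=> k0 h; apply/ler_addgt0Pr => e e0.
have k1 : 0 < k + 1 by rewrite ltr_wpDl.
pose delta := Num.min 2^-1 (e / (k + 1)).
have d0 : 0 < delta by rewrite lt_min invr_gt0 ltr0n divr_gt0.
apply: le_trans (h delta d0 _) _; first by rewrite ge_min lexx.
rewrite lerD2l; apply: (@le_trans _ _ (e / (k + 1) * k)).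
  by rewrite ler_wpM2r// ge_min lexx orbT.
rewrite mulrAC ler_pdivrMr// ler_wpM2l ?ltW//; lra.
Qed.

(** The number A for which L^(1 + beta) = A m^beta / t makes the iteration
    converge; k stands for the product of the constants of the bilinear form
    and of [cube_side], and 2^(-(1 + beta)/beta) is the ratio of the geometric
    decay. *)
Definition de_giorgi_const (R : realType) (beta k : R) : R :=
  8 * 16 `^ beta / (2 `^ (- ((1 + beta) / beta)) * k).

Section de_giorgi.
Context (R : realType) (N : nat) (s : R) (u : R -> 'rV[R]_N -> R) (m K : R).
Hypothesis hN : (0 < N)%N.
Hypothesis hs1 : s < 1.
Hypothesis const_gt0 : 0 < bilin_const N s.
Hypothesis energy_u : energy_identity s u.
Hypothesis u_ge0 : forall t, 0 < t -> {ae leb R N, forall x, 0 <= u t x}.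
Hypothesis int_u : forall t, 0 < t -> (leb R N).-integrable setT (EFin \o u t).
Hypothesis mass_u : forall t, 0 < t -> \int[leb R N]_x u t x = m.
Hypothesis K_gt0 : 0 < K.
Let beta : R := 2 * (1 - s) / N%:R.
Hypothesis cubeK : forall V : R, 0 < V -> exists rho : R,
  [/\ 0 < rho, (2 * rho) ^+ N = 2 * V &
    (Num.sqrt N%:R * rho) `^ (- (N%:R + 2 * (1 - s))) * V = K * V `^ (- beta)].

(** The energy identity for an approximate step between l1 and l2.  The lower
    bound E is kept separate from the excess at time t2: with E = 0 only the
    sign of the dissipation matters, which yields the monotonicity in time that
    later provides a positive E. *)
Lemma energy_dissipation l1 l2 t1 t2 delta V E :
  0 < l1 -> l1 < l2 -> 0 < t1 -> t1 < t2 -> 0 < delta -> delta <= 2^-1 ->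
  0 < V -> 0 <= E ->
  (forall t, t1 < t < t2 -> (leb R N [set x | (l1 < u t x)%R] <= V%:E)%E) ->
  (forall t, t1 < t < t2 -> E <= excess l2 (u t)) ->
  (1 - delta) * excess l2 (u t2) +
    (t2 - t1) * (bilin_const N s * (l1 * (1 - 2 * delta) * (K * V `^ (- beta))) * E)
  <= excess l1 (u t1) + delta * m.
Proof.
move=> l10 l12 t10 t12 d0 d2 V0 E0 superV E_le.
have t20 : 0 < t2 by exact: lt_trans t12.
have l20 : 0 < l2 by exact: lt_trans l12.
have [f [F [G [fFG F_le F_ge G_nd G_jump]]]] := approximate_step l10 l12 d0.
have [iF1 iF2 [int_B int_Bt] energy_eq] := energy_u fFG (ltW t10) t12.
have [rho [rho0 volV cubeV]] := cubeK V0.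
set c := (bilin_const N s * _ * E).
have kappa0 : 0 <= l1 * (1 - 2 * delta) by rewrite mulr_ge0 ?(ltW l10)//; lra.
have c0 : 0 <= c.
  rewrite mulr_ge0// mulr_ge0 ?(ltW const_gt0)// mulr_ge0//.
  by rewrite mulr_ge0 ?powR_ge0 ?(ltW K_gt0).
have iex1 := integrable_excess (ltW l10) (int_u t10).
have iex2 := integrable_excess (ltW l20) (int_u t20).
have F2_ge : (1 - delta) * excess l2 (u t2) <= \int[leb R N]_x F (u t2 x).
  rewrite /excess -RintegralZl//; apply: le_Rintegral_ae => //.
  - by have := integrableZl measurableT (1 - delta) iex2.
  - by apply: filterS (u_ge0 t20) => x ux _; case: (F_ge _ ux).
have F1_le : \int[leb R N]_x F (u t1 x) <= excess l1 (u t1) + delta * m.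
  have idu : (leb R N).-integrable setT (fun x => (delta * u t1 x)%:E).
    by have := integrableZl measurableT delta (int_u t10).
  rewrite -(mass_u t10) -RintegralZl//; last exact: int_u.
  rewrite /excess -RintegralD//; apply: le_Rintegral_ae => //.
  - exact: (integrableD measurableT iex1 idu).
  - by apply: filterS (u_ge0 t10) => x ux _; exact: F_le.
have B_ge : (t2 - t1) * c <=
    \int[leb_time]_(t in `]t1, t2[) bilin s (fun x => G (u t x)) (u t).
  have leb_itv : leb_time (`]t1, t2[%classic : set (measurableTypeR R)) = (t2 - t1)%:E.
    by rewrite [LHS]lebesgue_measure_itv/= lte_fin t12.
  have mI : measurable (`]t1, t2[%classic : set (measurableTypeR R)).
    exact: measurable_itv.
  have ic : leb_time.-integrable `]t1, t2[ (fun=> c%:E).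
    apply/integrableP; split; first exact: measurable_cst.
    by rewrite integral_cst// [X in (_ * X)%E]leb_itv -EFinM ltry.
  rewrite (_ : (t2 - t1) * c = \int[leb_time]_(t in `]t1, t2[) c); last first.
    by rewrite Rintegral_cst// [X in fine X]leb_itv mulrC.
  apply: le_Rintegral_ae => //.
  apply: (@filterS _ _ (ae_filter_ringOfSetsType leb_time) _ _ _ int_B) => t int_Bt' t12t.
  have t12t' : t1 < t < t2 by move: t12t; rewrite /= in_itv.
  have t0 : 0 < t by case/andP : t12t' => + _; exact: lt_trans.
  have := bilin_ge_excess hN (int_u t0) (u_ge0 t0) (int_Bt' t12t') G_nd l12
    kappa0 G_jump rho0 hs1 volV (superV _ t12t').
  rewrite -excess_EFin ?(ltW l20)//; last exact: int_u.
  rewrite -[leRHS]fineK; last by apply: integrable_fin_num => //; exact: int_Bt'.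
  rewrite -EFinM lee_fin -mulrA cubeV => h.
  rewrite /c /bilin -mulrA ler_pM2l//; apply: le_trans h.
  by rewrite ler_wpM2l ?E_le// mulr_ge0// mulr_ge0 ?powR_ge0 ?(ltW K_gt0).
lra.
Qed.

Lemma excess0_le t : 0 < t -> excess 0 (u t) <= m.
Proof.
move=> t0; rewrite -(mass_u t0); apply: le_Rintegral_ae => //.
- by apply: integrable_excess => //; exact: int_u.
- exact: int_u.
- by apply: filterS (u_ge0 t0) => x ux _; rewrite subr0 max_l.
Qed.

Let m_ge0 : 0 <= m.
Proof. exact: le_trans (excess_ge0 _ _) (excess0_le ltr01). Qed.

(** The gap between l1 and l2 leaves room for the approximate step; the error
    terms vanish in the limit delta -> 0. *)
Lemma excess_decreasing l1 l2 t1 t2 : 0 < l1 -> l1 < l2 -> 0 < t1 -> t1 < t2 ->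
  excess l2 (u t2) <= excess l1 (u t1).
Proof.
move=> l10 l12 t10 t12.
apply: (@le_of_le_add_small _ _ _ (excess l2 (u t2) + m)).
  by rewrite addr_ge0// excess_ge0.
move=> delta d0 d2.
(* A bound on the volume of {u > l1}, uniform in time; + 1 makes it positive. *)
have V0 : 0 < m / l1 + 1 by rewrite ltr_wpDl// divr_ge0// ltW.
have superV t : t1 < t < t2 -> (leb R N [set x | (l1 < u t x)%R] <= (m / l1 + 1)%:E)%E.
  move=> /andP[/(lt_trans t10) t0 _].
  apply: (markov_excess (lexx 0)) => //; first exact: int_u.
  apply: le_trans (excess0_le t0) _.
  by rewrite subr0 mulrDr mulrCA divff ?gt_eqF// !mulr1 lerDl ltW.
have E_le t : t1 < t < t2 -> 0 <= excess l2 (u t) by move=> _; exact: excess_ge0.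
have := energy_dissipation l10 l12 t10 t12 d0 d2 V0 (lexx 0) superV E_le.
rewrite !mulr0 addr0; lra.
Qed.

(** The interval [a, b] is cut into four: the first and the last quarter pay for
    the monotonicity in time, the second one for Chebyshev's bound on the volume
    of {u(t) > l1}, and the step of f lies in the third one.  The excess at
    (a, t1) is replaced by a bound X because it may vanish. *)
Lemma excess_step a b t1 t2 X : 0 < a -> a < b -> 0 < t1 -> t1 < t2 -> 0 < X ->
  excess a (u t1) <= X ->
  (t2 - t1) * (bilin_const N s * (a * (K * (4 * X / (b - a)) `^ (- beta)))) *
    excess b (u t2) <= X.
Proof.
move=> a0 ab t10 t12 X0 aX.
set V := 4 * X / (b - a); set E := excess b (u t2).
have ba0 : 0 < b - a by rewrite subr_gt0.
have V0 : 0 < V by rewrite divr_gt0// mulr_gt0.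
pose d := (b - a) / 4; pose l1 := a + 2 * d; pose l2 := a + 3 * d.
have d_gt0 : 0 < d by rewrite divr_gt0.
have bE : b = a + 4 * d by rewrite /d; field.
have E0 : 0 <= E by exact: excess_ge0.
have al1 : a <= l1 by rewrite /l1; lra.
have l10 : 0 < l1 by exact: lt_le_trans al1.
have l12 : l1 < l2 by rewrite /l1 /l2; lra.
have KV0 : 0 < K * V `^ (- beta) by rewrite mulr_gt0// powR_gt0.
have superV t : t1 < t < t2 -> (leb R N [set x | (l1 < u t x)%R] <= V%:E)%E.
  move=> /andP[t1t _]; have t0 : 0 < t by exact: lt_trans t1t.
  have ad0 : 0 < a + d by rewrite addr_gt0.
  have adl1 : a + d < l1 by rewrite /l1; lra.
  apply: (markov_excess (ltW ad0) adl1); first exact: int_u.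
  have aad : a < a + d by lra.
  apply: le_trans (excess_decreasing a0 aad t10 t1t) (le_trans aX _).
  rewrite (_ : (l1 - (a + d)) * V = X)// /l1 /V /d; field.
  by rewrite gt_eqF.
have E_le t : t1 < t < t2 -> E <= excess l2 (u t).
  move=> /andP[t1t tt2]; apply: excess_decreasing => //.
  - exact: lt_trans l12.
  - by rewrite bE /l2; lra.
  - exact: lt_trans t1t.
set P := (t2 - t1) * (bilin_const N s * (l1 * (K * V `^ (- beta)))) * E.
have P0 : 0 <= P.
  rewrite mulr_ge0// mulr_ge0 ?subr_ge0 ?(ltW t12)//.
  by rewrite mulr_ge0 ?(ltW const_gt0)// mulr_ge0// ltW.
have l1X : excess l1 (u t1) <= X.
  by apply: le_trans aX; apply: le_excess => //; [exact: ltW|exact: int_u].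
have PX : P <= X.
  apply: (@le_of_le_add_small _ _ _ (2 * P + m)); first by rewrite addr_ge0// mulr_ge0.
  move=> delta d0 d2.
  have := energy_dissipation l10 l12 t10 t12 d0 d2 V0 E0 superV E_le.
  rewrite (_ : (t2 - t1) * _ = P - delta * (2 * P)); last by rewrite /P; ring.
  have : 0 <= (1 - delta) * excess l2 (u t2) by rewrite mulr_ge0 ?excess_ge0//; lra.
  lra.
apply: le_trans PX; rewrite /P ler_wpM2r// ler_wpM2l ?subr_ge0 ?(ltW t12)//.
by rewrite ler_pM2l// ler_pM2r.
Qed.

Let beta_gt0 : 0 < beta.
Proof. by rewrite divr_gt0 ?mulr_gt0 ?subr_gt0 ?ltr0n. Qed.

Let q : R := 2 `^ (- ((1 + beta) / beta)).

Let q_gt0 : 0 < q.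
Proof. exact: powR_gt0. Qed.

Let q_lt1 : q < 1.
Proof.
have r0 : 0 < (1 + beta) / beta by rewrite divr_gt0// addr_gt0.
rewrite /q powRN invf_lt1 ?powR_gt0//.
have := @gt0_ltr_powR R _ r0 1 2; rewrite powR1 !nnegrE; apply=> //.
by rewrite ltr1n.
Qed.

(* q is chosen so that (2 q)^(-beta) = 2: this compensates exactly the factor 2
   lost at each iteration because the time step is halved. *)
Let two_q k : ((2 * q) ^+ k) `^ (- beta) = 2 ^+ k.
Proof.
have b0 : beta != 0 by rewrite gt_eqF.
have -> : 2 * q = 2 `^ (- beta^-1).
  rewrite /q -{1}[2]powRr1// -powRD; last by apply/implyP => _; rewrite gt_eqF.
  by congr (_ `^ _); field.
rewrite powR_natX -powRrM -powR_mulrn//; congr (_ `^ _); field.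
by [].
Qed.

(** Levels L (1 - 2^(-k-1)) and times t (1 - 2^(-k-1)).  The condition on L
    makes each step turn the bound X q^k into X q^(k+1). *)
Lemma excess_eq0 L t X : 0 < L -> 0 < t -> 0 < X -> m <= X ->
  1 <= q * (t * bilin_const N s * K * L / 8) * (16 * X / L) `^ (- beta) ->
  excess L (u t) = 0.
Proof.
move=> L0 t0 X0 mX hL.
pose h k : R := 2^-1 ^+ k.+1.
have h_gt0 k : 0 < h k by rewrite exprn_gt0// invr_gt0.
have h_le k : h k <= 2^-1.
  by rewrite /h exprS ler_piMr ?invr_ge0// exprn_ile1// ?invr_ge0// invf_le1// ler1n.
have hS k : h k.+1 = h k / 2 by rewrite /h exprSr.
pose a k := L * (1 - h k); pose tau k := t * (1 - h k).
have half_lt1 : 2^-1 < 1 :> R by rewrite invf_lt1// ltr1n.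
have a_lt k : a k < a k.+1.
  by rewrite /a ltr_pM2l// hS; have := h_gt0 k; lra.
have tau_lt k : tau k < tau k.+1.
  by rewrite /tau ltr_pM2l// hS; have := h_gt0 k; lra.
have a_ge k : L / 2 <= a k.
  by rewrite /a ler_pM2l//; have := h_le k; lra.
have a_gt0 k : 0 < a k by apply: lt_le_trans (a_ge k); rewrite divr_gt0.
have tau_gt0 k : 0 < tau k.
  by rewrite /tau mulr_gt0//; have := h_le k; lra.
have iter k : excess (a k) (u (tau k)) <= X * q ^+ k.
  elim: k => [|k IH].
    rewrite expr0 mulr1; apply: le_trans mX; apply: le_trans (excess0_le (tau_gt0 0%N)).
    by apply: le_excess => //; [exact: ltW|exact: int_u].
  have Xq0 : 0 < X * q ^+ k by rewrite mulr_gt0// exprn_gt0.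
  have := excess_step (a_gt0 k) (a_lt k) (tau_gt0 k) (tau_lt k) Xq0 IH.
  rewrite (_ : a k.+1 - a k = L * h k / 2); last by rewrite /a hS; field.
  rewrite (_ : tau k.+1 - tau k = t * h k / 2); last by rewrite /tau hS; field.
  have hk2 : h k * 2 ^+ k = 2^-1.
    by rewrite /h exprS -mulrA -exprMn mulVf// expr1n mulr1.
  have hE : h k = 2^-1 / 2 ^+ k by rewrite -hk2 mulfK// expf_neq0.
  rewrite (_ : 4 * (X * q ^+ k) / (L * h k / 2) = 16 * X / L * (2 * q) ^+ k); last first.
    rewrite exprMn hE; field.
    by rewrite gt_eqF// expf_neq0.
  rewrite powRM; last 2 first.
  - by rewrite divr_ge0 ?(ltW L0)// mulr_ge0// ltW.
  - by rewrite exprn_ge0// mulr_ge0// ltW.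
  rewrite two_q; set Y := (16 * X / L) `^ (- beta); set U := excess _ _ => step.
  have U0 : 0 <= U by exact: excess_ge0.
  have Y0 : 0 < Y by rewrite powR_gt0// divr_gt0// mulr_gt0.
  rewrite exprSr mulrA -ler_pdivrMr//.
  apply: le_trans step; rewrite ler_pdivrMr//.
  rewrite -[leLHS]mul1r mulrAC; apply: ler_wpM2r => //.
  apply: le_trans hL _.
  rewrite (_ : q * _ * Y = t * h k / 2 * (bilin_const N s * (L / 2 * (K * (Y * 2 ^+ k)))) * q).
    rewrite ler_pM2r// ler_pM2l ?divr_gt0 ?mulr_gt0// ler_pM2l// ler_pM2r//.
    by rewrite !mulr_gt0// exprn_gt0.
  by rewrite hE; field; rewrite expf_neq0.
apply/eqP; rewrite eq_le excess_ge0 andbT.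
have Uk k : excess L (u t) <= X * q ^+ k.
  apply: le_trans (iter k); apply: excess_decreasing => //.
  - by rewrite /a -[ltRHS]mulr1 ltr_pM2l//; have := h_gt0 k; lra.
  - by rewrite /tau -[ltRHS]mulr1 ltr_pM2l//; have := h_gt0 k; lra.
have cvgq : X * q ^+ k @[k --> \oo] --> X * 0.
  by apply: cvgM; [exact: cvg_cst|apply: cvg_expr; rewrite gtr0_norm].
rewrite -[leRHS](mulr0 X) -(cvg_lim _ cvgq)//.
by apply: limr_ge; [apply/cvg_ex; eexists; exact: cvgq|exact: nearW].
Qed.

(** The level is the one for which the condition of [excess_eq0], with X = m,
    holds with equality. *)
Lemma excess_smoothing t : 0 < t -> 0 < m ->
  excess (de_giorgi_const beta (bilin_const N s * K) `^ (1 + beta)^-1 *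
    t `^ (- (1 + beta)^-1) * m `^ (beta / (1 + beta))) (u t) = 0.
Proof.
move=> t0 m0; set A := de_giorgi_const _ _; set L := (X in excess X _).
have cK : 0 < bilin_const N s * K by rewrite mulr_gt0.
have A0 : 0 < A.
  by apply: divr_gt0; apply: mulr_gt0 => //; exact: powR_gt0.
have L0 : 0 < L by apply: mulr_gt0; [apply: mulr_gt0|]; exact: powR_gt0.
have b1 : 1 + beta != 0 by rewrite gt_eqF// addr_gt0.
apply: (@excess_eq0 L t m) => //.
have L1 : L * L `^ beta = A / t * m `^ beta.
  rewrite -{1}[L]powRr1 ?(ltW L0)// -powRD; last first.
    by apply/implyP => _; rewrite gt_eqF.
  rewrite /L (@powRM _ (A `^ _ * t `^ _)) ?mulr_ge0 ?powR_ge0//.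
  rewrite (@powRM _ (A `^ _)) ?powR_ge0// -!powRrM.
  rewrite mulNr mulVf// powRr1 ?(ltW A0)// powRN powRr1 ?(ltW t0)//.
  by rewrite divfK.
have -> : (16 * m / L) `^ (- beta) = L `^ beta / (16 `^ beta * m `^ beta).
  have LV : L^-1 `^ beta = (L `^ beta)^-1.
    by rewrite -powR_inv1 ?(ltW L0)// -powRrM mulN1r powRN.
  have Li0 : 0 <= L^-1 by rewrite invr_ge0 ltW.
  have m160 : 0 <= 16 * m by rewrite mulr_ge0// ltW.
  rewrite powRN (powRM _ m160 Li0) (powRM _ (ler0n _ 16) (ltW m0)) LV.
  by rewrite invfM invrK mulrC.
rewrite (_ : _ * _ = q * t * bilin_const N s * K / (8 * (16 `^ beta * m `^ beta)) *
    (L * L `^ beta)); last first.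
  by field; rewrite !gt_eqF ?powR_gt0.
rewrite L1 /A /de_giorgi_const -/q le_eqVlt; apply/orP; left; apply/eqP; field.
by rewrite !gt_eqF// powR_gt0.
Qed.

End de_giorgi.

(** * The smoothing estimate *)

Lemma ae_le_of_excess_eq0 (R : realType) (N : nat) (l : R) (w : 'rV[R]_N -> R) :
  0 <= l -> (leb R N).-integrable setT (EFin \o w) -> excess l w = 0 ->
  {ae leb R N, forall x, w x <= l}.
Proof.
move=> l0 iw e0; have iex := integrable_excess l0 iw.
have mex : measurable_fun setT (fun x => (Num.max (w x - l) 0)%:E).
  by case/integrableP : iex.
have [+ _] := ae_eq_integral_abs (leb R N) measurableT mex.
have -> : (\int[leb R N]_x `|(Num.max (w x - l) 0)%:E| = 0)%E.
  transitivity (excess l w)%:E; last by rewrite e0.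
  rewrite excess_EFin//; apply: eq_integral => x _.
  by rewrite gee0_abs ?lee_fin ?le_max ?lexx ?orbT.
move=> /(_ erefl); apply: filterS => x /(_ I) [h].
by rewrite -subr_le0 -h le_max lexx.
Qed.

Lemma bilin_const_gt0 (R : realType) (N : nat) (s : R) :
  0 < s -> s < 1 -> 2 * s < N%:R -> 0 < bilin_const N s.
Proof.
move=> s0 s1 sN; rewrite /bilin_const /riesz_const.
have G1 : 0 < Gamma (N%:R / 2 - s) by apply: Gamma_gt0; lra.
have G2 := Gamma_gt0 s0.
apply: mulr_gt0; last by rewrite subr_gt0.
apply: mulr_gt0; last by rewrite subr_gt0.
apply: divr_gt0 => //; apply: mulr_gt0 => //.
by apply: mulr_gt0; apply: powR_gt0 => //; exact: pi_gt0.
Qed.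

Lemma Lnorm_oo_le d (T : measurableType d) (R : realType)
    (mu : {measure set T -> \bar R}) (w : T -> R) (L : R) :
  0 <= L -> {ae mu, forall x, `|w x| <= L} -> ('N[mu]_+oo[EFin \o w] <= L%:E)%E.
Proof.
move=> L0 wL; rewrite unlock; case: ifP => _; last by rewrite lee_fin.
by apply/ess_supP; apply: filterS wL => x; rewrite /= lee_fin.
Qed.

Theorem theorem4p1 (R : realType) (N : nat) (s : R)
    (hN : (1 <= N)%N) (hs0 : 0 < s) (hs1 : s < 1)
    (hs : N = 1%N -> s < 1 / 2) :
  exists2 C : R, 0 < C &
    forall (u0 : 'rV[R]_N -> R) (u : R -> 'rV[R]_N -> R),
      (leb R N).-integrable setT (EFin \o u0) ->
      ('N[leb R N]_+oo[EFin \o u0] < +oo)%E ->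
      {ae leb R N, forall x, 0 <= u0 x} ->
      constructed_solution s u0 u ->
      forall t : R, 0 < t ->
        let alpha := N%:R / (N%:R + 2 - 2 * s) in
        let gamma := (2 - 2 * s) / (N%:R + 2 - 2 * s) in
        ('N[leb R N]_+oo[EFin \o u t]
          <= (C * t `^ (- alpha) * fine 'N[leb R N]_1[EFin \o u0] `^ gamma)%:E)%E.
Proof.
have n0 : 0 < N%:R :> R by rewrite ltr0n.
have sN : 2 * s < N%:R.
  case: N hN hs {n0} => [//|[|n]] _ hs1'; first by have := hs1' erefl; lra.
  rewrite -[n.+2%:R]natr1 -[n.+1%:R]natr1.
  by have := ler0n R n; lra.
have Bgt0 := bilin_const_gt0 hs0 hs1 sN.
pose beta : R := 2 * (1 - s) / N%:R.
have beta0 : 0 < beta by rewrite divr_gt0// mulr_gt0// subr_gt0.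
have [K K0 cubeK] := cube_side (N%:R + 2 * (1 - s)) hN.
have qE : 1 - (N%:R + 2 * (1 - s)) / N%:R = - beta.
  by rewrite /beta; field; rewrite gt_eqF.
rewrite qE in cubeK.
pose A := de_giorgi_const beta (bilin_const N s * K) `^ (1 + beta)^-1.
exists A.
  apply: powR_gt0; apply: divr_gt0; apply: mulr_gt0 => //; try exact: powR_gt0.
  exact: mulr_gt0.
move=> u0 u iu0 _ u0_ge0 [S [Sprop _ _] Su] t t0; cbv zeta.
set alpha := N%:R / _; set gamma := (2 - 2 * s) / _.
have [p [q cp]] := Sprop _ _ Su.
have [_ _ _ energy_u _] := cp_energy cp.
have u_ge0 := cp_ge0 cp; have int_u := cp_integrable cp.
have den0 : 0 < N%:R + 2 - 2 * s by have := n0; lra.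
have alphaE : alpha = (1 + beta)^-1.
  by rewrite /alpha /beta; field; rewrite !gt_eqF//; lra.
have gammaE : gamma = beta / (1 + beta).
  by rewrite /gamma /beta; field; rewrite !gt_eqF//; lra.
set m := fine _.
have mE : \int[leb R N]_x u0 x = m.
  rewrite /m Lnorm1 /Rintegral; congr fine; apply: ae_eq_integral => //.
  - by case/integrableP : iu0.
  - by apply: measurableT_comp => //; case/integrableP : iu0.
  - by apply: filterS u0_ge0 => x ux _; rewrite /= ger0_norm.
have mass_u t' : 0 < t' -> \int[leb R N]_x u t' x = m.
  by move=> t'0; rewrite (cp_mass cp).
set L := (_ * _ `^ gamma).
have L0 : 0 <= L by rewrite mulr_ge0 ?powR_ge0// mulr_ge0 ?powR_ge0.
apply: Lnorm_oo_le => //.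
suff : {ae leb R N, forall x, u t x <= L}.
  by move=> uL; near=> x; rewrite ger0_norm; near: x => //; exact: u_ge0.
have m0 : 0 <= m by apply: fine_ge0; exact: Lnorm_ge0.
move: m0; rewrite le_eqVlt => /orP[/eqP m0|m0].
  have e0 : excess 0 (u t) = 0.
    apply/eqP; rewrite eq_le excess_ge0 andbT [leRHS]m0.
    exact: (excess0_le u_ge0 int_u mass_u t0).
  apply: filterS (ae_le_of_excess_eq0 (lexx 0) (int_u _ t0) e0) => x.
  by move=> /le_trans; apply.
apply: ae_le_of_excess_eq0 => //; first exact: int_u.
have := excess_smoothing hN hs1 Bgt0 energy_u u_ge0 int_u mass_u K0 cubeK t0 m0.
by rewrite /L alphaE gammaE.
Unshelve. all: by end_near.
Qed.
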